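(* Let $n\geq 1$, let $G$ be a finite group and let $D\colon G\to \mathrm{GL}(d,\mathbb{R})$ be a faithful representation such that the representation polytope $P(D)=\operatorname{conv}\{D(g)\mid g\in G\}$ is combinatorially equivalent to the Birkhoff polytope $B_n=\operatorname{conv}\{P(\sigma)\mid \sigma\in S_n\}$. Then either $n=3$ and $G$ is cyclic of order $6$, or $D$ and the standard permutation representation $P\colon S_n\to\mathrm{GL}(n,\mathbb{R})$ are effectively equivalent (in particular $G\cong S_n$).
   Context: $P\colon S_n\to \mathrm{GL}(n,\mathbb{R})$ denotes the standard permutation representation of the symmetric group (sending $\sigma$ to its $n\times n$ permutation matrix). For a real representation $D\colon G\to\mathrm{GL}(d,\mathbb{R})$ of a finite group, the representation polytope is $P(D)=\operatorname{conv}\{D(g)\mid g\in G\}\subseteq \mathbb{R}^{d\times d}$. Two polytopes are combinatorially equivalent if there is a bijection between their vertex sets mapping faces onto faces. Two representations $D_i\colon G_i\to \mathrm{GL}(d_i,\mathbb{R})$ ($i=1,2$) are effectively equivalent if there is a group isomorphism $\phi\colon G_1\to G_2$ such that $D_1$ and $D_2\circ\phi$ are stably equivalent, i.e. have the same nontrivial irreducible constituents (not necessarily with the same multiplicities). *)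

(* Defs.v *)
From HB Require Import structures.
From mathcomp Require Import all_boot all_order all_algebra.
From mathcomp Require Import all_fingroup all_solvable all_field all_character.
From mathcomp Require Import all_classical all_reals.

Set Implicit Arguments.
Unset Strict Implicit.
Unset Printing Implicit Defensive.

Import Order.TTheory GRing.Theory Num.Theory.
Local Open Scope classical_set_scope.
Local Open Scope ring_scope.

Section Polytopes.
Variable R : realType.

Definition conv_hull (V : vectType R) (A : set V) : set V :=
  [set x | exists (k : nat) (w : 'I_k -> R) (p : 'I_k -> V),
     [/\ forall i, 0 <= w i, \sum_i w i = 1, forall i, A (p i)
       & x = \sum_i w i *: p i]].

(* Taking c = 0 shows that the empty set and P itself are faces. *)
Definition face (V : vectType R) (P F : set V) : Prop :=
  exists (c : {scalar V}) (b : R),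
    (forall x, P x -> c x <= b) /\ F = [set x | P x /\ c x = b].

Definition vertices (V : vectType R) (P : set V) : set V :=
  [set v | face P [set v]].

Definition face_vertices (V : vectType R) (P S : set V) : Prop :=
  exists2 F, face P F & S = F `&` vertices P.

(* "Mapping faces onto faces" is read in both directions, so that f induces an
   isomorphism of face lattices: the one-way condition alone would relate a
   square to a tetrahedron. *)
Definition comb_equiv (V W : vectType R) (P : set V) (Q : set W) : Prop :=
  exists f : V -> W, set_bij (vertices P) (vertices Q) f /\
    forall S, S `<=` vertices P ->
      (face_vertices P S <-> face_vertices Q (f @` S)).

End Polytopes.

Section Representations.
Variable R : realType.

Definition rep_polytope (gT : finGroupType) (G : {group gT}) d
    (D : mx_representation R G d) : set 'M[R]_d :=
  conv_hull [set D g | g in [set` G]].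

Lemma perm_mx_repr n : mx_repr [set: 'S_n]%G (@perm_mx R n).
Proof. by split=> [|s t _ _]; rewrite ?perm_mx1 ?perm_mxM. Qed.

(* The product s * t of 'S_n applies s first, and perm_mx s has its entries 1
   at the positions (i, s i), so perm_mx is indeed a homomorphism. *)
Definition perm_repr n : mx_representation R [set: 'S_n]%G n :=
  MxRepresentation (perm_mx_repr n).

Definition Birkhoff n : set 'M[R]_n := rep_polytope (perm_repr n).

(* By Maschke's theorem every irreducible constituent occurs as a submodule. *)
Definition constituent (gT : finGroupType) (G : {group gT}) m d
    (S : mx_representation R G m) (D : mx_representation R G d) : Prop :=
  mx_irreducible S /\
  exists (U : 'M[R]_d) (modU : mxmodule D U), mx_rsim S (submod_repr modU).

Definition nontrivial_repr (gT : finGroupType) (G : {group gT}) m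
    (S : mx_representation R G m) : Prop :=
  ~~ (G \subset rker S).

Definition stably_equiv (gT : finGroupType) (G : {group gT}) d1 d2
    (D1 : mx_representation R G d1) (D2 : mx_representation R G d2) : Prop :=
  forall m (S : mx_representation R G m), nontrivial_repr S ->
    (constituent S D1 <-> constituent S D2).

(* subg_repr (morphpre_repr phi D2) sG12 is the composite of phi and D2. *)
Definition effectively_equiv (gT1 gT2 : finGroupType)
    (G1 : {group gT1}) (G2 : {group gT2}) d1 d2
    (D1 : mx_representation R G1 d1) (D2 : mx_representation R G2 d2) : Prop :=
  exists (phi : {morphism G1 >-> gT2}) (sG12 : G1 \subset (phi @*^-1 G2)%g),
    isom G1 G2 phi /\
    stably_equiv D1 (subg_repr (morphpre_repr phi D2) sG12).

End Representations.

(* Main.v *)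
Require Import Defs.
From HB Require Import structures.
From mathcomp Require Import all_boot all_order all_algebra.
From mathcomp Require Import all_fingroup all_solvable all_field all_character.
From mathcomp Require Import all_classical all_reals.
From mathcomp Require Import fintype finset zify ring.

Set Implicit Arguments.
Unset Strict Implicit.
Unset Printing Implicit Defensive.

Import Order.TTheory GRing.Theory Num.Theory.

(** A face of P(D) is the zero set of a nonnegative function on G of the form
    g |-> tr(M D(g)) + b; call such functions affine.  By Hall's theorem the
    support of a nonzero nonnegative affine function for the permutation
    representation contains a cell C(i,j) = {s | s(i) = j}, so a combinatorial
    equivalence amounts to a bijection F : G -> S_n under which the F^-1 C(i,j)
    are the minimal supports of the affine functions of D.

    Left and right translations of G permute these n^2 sets.  A permutation of
    S_n which permutes the cells preserves the rook graph on the index pairs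
    (i,j), hence has the form s |-> a s b or s |-> a s^-1 b.  So G gives two
    commuting regular groups of such maps.  If no inversion occurs, this yields
    factorizations S_n = MT = M'T' with M' centralising M and T' centralising T,
    and orbit counting forces M = 1 or T = 1 for n >= 4, i.e. F is an isomorphism
    or an anti-isomorphism up to translation.  If inversions occur, the parity
    of ab shows that the other maps give A_n in place of S_n, with M, T conjugate,
    which is excluded by orders.  For n = 3 only the sign of F is multiplicative,
    and the sign determines the cells.

    Once F may be taken to be an isomorphism, averaging over point stabilisers
    shows that the indicators of the cells are affine for D; subtracting
    multiples of them from a nonnegative affine function kills it, so D and P
    have the same affine functions.  Schur's lemma recovers from these the
    nontrivial irreducible constituents. *)

(** * Factorizations of symmetric groups *)

Section PermGroups.
Local Open Scope group_scope.
Variable n : nat.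
Implicit Types (M T X Y : {group 'S_n}) (p q : 'I_n).

Definition orb (M : {set 'S_n}) p : {set 'I_n} := [set m p | m : 'S_n in M].

Definition trans (M : {set 'S_n}) := forall p, orb M p = [set: 'I_n].

Lemma orb_refl M p : p \in orb M p.
Proof. by apply/imsetP; exists 1; rewrite ?group1 ?perm1. Qed.

Lemma orbM M p q m : m \in M -> (m q \in orb M p) = (q \in orb M p).
Proof.
move=> mM; apply/imsetP/imsetP => [[a aM e]|[a aM ->]].
  by exists (a * m^-1); rewrite ?groupM ?groupV // permM -e permK.
by exists (a * m); rewrite ?groupM // permM.
Qed.

Lemma orb_disjoint M p q r : q \notin orb M p -> r \in orb M p -> r \notin orb M q.
Proof.
move=> qp /imsetP[a aM ->]; apply: contra qp => /imsetP[b bM e].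
have -> : q = (a * b^-1) p by rewrite permM e permK.
by rewrite orbM ?orb_refl // groupM ?groupV.
Qed.

(** An element of [X] is determined by its value at [p]: by commutation on the orbit, by bijectivity
    at the at most one point left. *)
Lemma card_perm_commute_le M X p :
  X \subset 'C(M) -> n <= #|orb M p|.+1 -> #|X| <= n.
Proof.
move=> /centsP cXM hO.
have inj : {in X &, injective (fun x : 'S_n => x p)}.
  move=> x y xX yX /= exy.
  have e q : q \in orb M p -> x q = y q.
    case/imsetP=> m mM ->; rewrite -!permM -(cXM x xX m mM) -(cXM y yX m mM).
    by rewrite !permM exy.
  have hC : #|~: orb M p| <= 1.
    by have := cardsC (orb M p); rewrite card_ord; lia.
  apply/permP => q; case: (boolP (q \in orb M p)) => [/e //|qO].
  apply/eqP; apply/contraT => ne.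
  have eqq r : r \notin orb M p -> r = q.
    move=> rO; move/card_le1_eqP: hC => h; apply: h; by rewrite inE.
  (* x q = y r for some r; if r <> q, it lies in the orbit, where x = y. *)
  pose r := y^-1 (x q).
  have er : y r = x q by rewrite /r permKV.
  have rq : r != q by apply: contra ne => /eqP rq; rewrite -er rq.
  have rO : r \in orb M p by apply: contraT => /eqq /eqP; rewrite (negbTE rq).
  by rewrite -(e r rO) in er; move/perm_inj: er => er; rewrite er eqxx in rq.
rewrite -(card_in_imset inj) -[X in _ <= X]card_ord; exact: max_card.
Qed.

(** Distinct indices give distinct cosets of [X], and each of these cosets meets [Y]. *)
Lemma card_le_cosets (I : finType) (A : {set I}) (f : I -> 'S_n) X (Y : {set 'S_n}) :
  (forall i, i \in A -> f i \in X * Y) ->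
  {in A &, forall i j, f i * (f j)^-1 \in X -> i = j} -> #|A| <= #|Y|.
Proof.
move=> hXY inj.
pose g i := odflt 1 [pick y in Y | f i * y^-1 \in X].
have gP i : i \in A -> g i \in Y /\ f i * (g i)^-1 \in X.
  move=> /hXY /mulsgP[x y xX yY e]; rewrite /g; case: pickP => [z /andP[] //|/(_ y)].
  by rewrite yY e mulgK xX.
have ginj : {in A &, injective g}.
  move=> i j iA jA e; apply: inj => //.
  have [_ h1] := gP i iA; have [_ h2] := gP j jA.
  by have := groupM h1 (groupVr h2); rewrite invMg invgK e mulgA mulgKV.
rewrite -(card_in_imset ginj); apply/subset_leq_card/subsetP => y /imsetP[i iA ->].
by have [] := gP i iA.
Qed.

(** The coset [M s] determines the image of the orbit under [s]; the identity and the swaps of a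
    point inside with one outside give distinct images. *)
Lemma card_factor_orbit M (Y : {set 'S_n}) p :
  M * Y = [set: 'S_n] -> (#|orb M p| * (n - #|orb M p|)).+1 <= #|Y|.
Proof.
set O := orb M p => hMY.
(* [None] stands for the identity and accounts for the successor in the bound. *)
pose A : {set option ('I_n * 'I_n)} := None |: [set Some x | x in setX O (~: O)].
have cA : #|A| = (#|O| * (n - #|O|)).+1.
  rewrite cardsU1 card_imset ?cardsX; last by move=> ? ? [].
  have -> : #|~: O| = n - #|O| by have := cardsC O; rewrite card_ord; lia.
  by rewrite (_ : None \notin _) //; apply/imsetP => -[].
rewrite -cA.
pose f (x : option ('I_n * 'I_n)) : 'S_n := if x is Some (q, r) then tperm q r else 1.
apply: (@card_le_cosets _ A f M); first by move=> i _; rewrite hMY inE.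
have fV i : (f i)^-1 = f i by case: i => [[q r]|]; rewrite /= ?invg1 // tpermV.
have key i j : f i * (f j)^-1 \in M -> forall q, (f i q \in O) = (f j q \in O).
  by move=> h q; rewrite -[in LHS](orbM _ _ h) -permM -{1}(fV i) mulgA mulVg mul1g fV.
have mem i : i \in A -> if i is Some (q, r) then (q \in O) && (r \notin O) else true.
  by case: i => [[q r]|//]; rewrite !inE /= => /imsetP[x + [ex]]; rewrite -ex !inE.
have step q r j : q \in O -> r \notin O -> j \in A ->
    (forall x, (tperm q r x \in O) = (f j x \in O)) -> Some (q, r) = j.
  move=> qO rO /mem; case: j => [[q' r'] /andP[qO' rO'] /= e|_ /= /(_ q)].
    have [eq'|nq] := eqVneq q q'; last first.
      move: (e q); rewrite tpermL (negbTE rO) tpermD ?qO // 1?eq_sym //.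
      by apply: contraNneq rO' => <-.
    move: (e r); rewrite tpermR qO -eq'; case: tpermP => [er|er|_ _].
    - by rewrite er qO in rO.
    - by rewrite er.
    - by rewrite (negbTE rO).
  by rewrite tpermL perm1 qO (negbTE rO).
move=> i j iA jA /key e; move: (mem i iA).
case: i iA e => [[q r] _ e /andP[qO rO]|_ e _]; first exact: step.
case: j jA e => [[q r] jA e|//]; have /andP[qO rO] := mem _ jA.
symmetry; apply: step => //; first by rewrite !inE eqxx.
Qed.

(** The swaps of [p] with [q], for [q] equal to [p] or outside the orbit, lie in distinct cosets of
    [X]. *)
Lemma card_factor_centraliser M X (Y : {set 'S_n}) p :
  X \subset 'C(M) -> X * Y = [set: 'S_n] -> 1 < #|orb M p| ->
  n < #|orb M p| + #|Y|.
Proof.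
set O := orb M p => /centsP cXM hXY O1.
have [p2 p2O np2] : exists2 p2, p2 \in O & p2 != p.
  move: O1; rewrite (cardsD1 p) orb_refl => /card_gt0P[p2].
  by rewrite !inE => /andP[? ?]; exists p2.
have : #|p |: ~: O| <= #|Y|.
  apply: (@card_le_cosets _ _ (fun q => tperm p q) X).
    by move=> i _; rewrite hXY inE.
  move=> q r; rewrite !inE => hq hr; rewrite tpermV => hX.
  apply/eqP/contraT => nqr.
  (* The product commutes with M, so its support is M-stable; but it meets O in p only. *)
  case/imsetP: p2O => m mM e2.
  have := congr1 (fun s : 'S_n => s p) (cXM _ hX m mM).
  rewrite !permM tpermL -e2.
  have d2 z : (z == p) || (z \notin O) -> z != p2.
    by case/orP=> [/eqP->|h]; rewrite 1?eq_sym //; apply: contraNneq h => <-; apply/imsetP; exists m.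
  rewrite (tpermD _ (d2 _ hq)) 1?eq_sym // (tpermD _ (d2 _ hr)) 1?eq_sym //.
  rewrite e2 => /perm_inj; case: tpermP => [eqp erp|eqr _|nqp _ /nqp //].
    by rewrite eqp erp eqxx in nqr.
  by rewrite eqr eqxx in nqr.
rewrite cardsU1 inE orb_refl add1n => h.
have e := cardsC O; rewrite card_ord in e.
by rewrite -[X in X < _]e ltn_add2l.
Qed.

Lemma exists_perm2 (u v y z : 'I_n) :
  u != v -> y != z -> exists2 s : 'S_n, s u = y & s v = z.
Proof.
move=> nuv nyz.
exists (tperm u y * tperm (tperm u y v) z); rewrite permM ?tpermL //.
have h : tperm u y v != y.
  by apply: contraNneq nuv => e; rewrite -(tpermK u y v) e tpermR.
by rewrite (@tpermD _ (tperm u y v) z y) // eq_sym.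
Qed.

(** The number of points of an [M]-orbit sent by [s] into a [T]-orbit is constant on double cosets,
    hence on even permutations; if neither group is transitive, this contradicts its change under a
    transposition. *)
Lemma alt_factor_trans M T : 2 < n ->
  'Alt_('I_n) \subset M * T -> (trans M) \/ (trans T).
Proof.
move=> n3 /subsetP hMT; have [tM|tM] := pselect (trans M); first by left.
right=> y; apply/eqP; rewrite eqEsubset subsetT; apply/subsetP => z _.
apply: contraT => zy; exfalso; apply: tM => u.
apply/eqP; rewrite eqEsubset subsetT; apply/subsetP => v _.
apply: contraT => vu; exfalso.
set O := orb M u in vu; set E := orb T y in zy.
pose N (s : 'S_n) := #|[set q in O | s q \in E]|.
have NM m s : m \in M -> N (m * s) = N s.
  move=> mM; rewrite /N -(card_imset [set q in O | (m * s) q \in E] (@perm_inj _ m)).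
  congr #|pred_of_set _|; apply/setP=> q; rewrite inE; apply/imsetP/andP.
    by case=> r; rewrite !inE permM => /andP[rO rE] ->; rewrite orbM.
  case=> qO qE; exists (m^-1 q); rewrite ?permKV // inE permM permKV qE andbT.
  by rewrite orbM ?groupV.
have NT t s : t \in T -> N (s * t) = N s.
  by move=> tT; apply: eq_card => q; rewrite !inE permM orbM.
have Neven s : ~~ odd_perm s -> N s = N 1.
  move=> es; have : s \in M * T by apply: hMT; rewrite Alt_even.
  by case/mulsgP=> m t mM tT ->; rewrite NM // -{1}(mul1g t) NT.
(* A transposition inside O or inside its complement changes parity but not N. *)
have [w [x [wx ewx]]] : exists w x, w != x /\ (w \in O) = (x \in O).
  have [c c1 c2] : exists2 c : 'I_n, c != u & c != v.
    have : 0 < #|~: [set u; v]|.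
      by have := cardsC [set u; v]; rewrite card_ord cards2; lia.
    by case/card_gt0P=> c; rewrite !inE negb_or => /andP[h1 h2]; exists c.
  have uO : u \in O by exact: orb_refl.
  case: (boolP (c \in O)) => cO; [exists c, u | exists c, v].
    by rewrite cO uO.
  by rewrite (negbTE cO) (negbTE vu).
have tO q : (tperm w x q \in O) = (q \in O) by case: tpermP => // ->.
have Ntp s : N (tperm w x * s) = N s.
  rewrite /N -(card_imset [set q in O | (tperm w x * s) q \in E] (@perm_inj _ (tperm w x))).
  congr #|pred_of_set _|; apply/setP=> q; rewrite inE; apply/imsetP/andP.
    by case=> r; rewrite !inE permM => /andP[rO rE] ->; rewrite tO.
  by case=> qO qE; exists (tperm w x q); rewrite ?tpermK // inE permM tpermK qE tO qO.
have Nall s : N s = N 1.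
  have [hs|hs] := boolP (odd_perm s); last exact: Neven.
  by rewrite -Ntp Neven // odd_permM odd_tperm wx hs.
have nuv : u != v by apply: contraNneq vu => <-; exact: orb_refl.
have nyz : y != z by apply: contraNneq zy => <-; exact: orb_refl.
have [s su sv] := exists_perm2 nuv nyz.
(* [s] sends [u] into [E] and [v] outside it, so the swap loses exactly the point [u]. *)
have : N s = (N (tperm u v * s)).+1.
  rewrite /N (cardsD1 u) !inE orb_refl su orb_refl /= add1n; congr _.+1.
  apply: eq_card => q; rewrite !inE permM; case: tpermP => [->|->|/eqP hu /eqP hv].
  - by rewrite eqxx /= sv (negbTE zy) andbF.
  - by rewrite (negbTE vu) !andbF.
  - by rewrite hu.
by rewrite !Nall => /eqP; rewrite -[X in X == _]addn0 -addn1 eqn_add2l.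
Qed.

Lemma cent_Alt : 3 < n -> 'C('Alt_('I_n)) = 1 :> {set 'S_n}.
Proof.
move=> n4; apply/trivgP/subsetP => s /centP cs; rewrite inE; apply/eqP/permP=> i.
rewrite perm1; apply/eqP/contraT => nsi.
have : 1 < #|~: [set i; s i]|.
  by have := cardsC [set i; s i]; rewrite card_ord cards2; lia.
case/card_gt1P=> j [k [+ + njk]]; rewrite !inE !negb_or => /andP[ji js] /andP[ki ks].
(* This 3-cycle moves [i] but fixes [s i]. *)
have ht : tperm i j * tperm j k \in 'Alt_('I_n).
  by rewrite Alt_even odd_permM !odd_tperm njk eq_sym ji.
have := congr1 (fun t : 'S_n => t i) (cs _ ht).
rewrite !permM tpermL tpermL !tpermD // 1?eq_sym //.
by move=> /perm_inj e; rewrite e eqxx in ki.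
Qed.

Lemma trans_of_factor M T : 2 < n -> M * T = [set: 'S_n] -> trans M \/ trans T.
Proof. by move=> n3 e; apply: alt_factor_trans; rewrite // e subsetT. Qed.

Lemma card_trans_commute M X : 0 < n -> trans M -> X \subset 'C(M) -> #|X| <= n.
Proof.
move=> n0 tM cX; apply: (@card_perm_commute_le M X (Ordinal n0)) => //.
by rewrite tM cardsT card_ord.
Qed.

Lemma center_Sn : 3 < n -> 'C([set: 'S_n]) = 1 :> {set 'S_n}.
Proof.
by move=> n4; apply/trivgP; rewrite -(cent_Alt n4) centS ?subsetT.
Qed.

Lemma fact_gt_id k : 3 < k -> k < (k.-1)`!.
Proof.
case: k => [|[|[|[|k]]]] // _; elim: k => [//|k IH].
by rewrite factS /=; move: IH => /=; set x := _`!; nia.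
Qed.

Lemma ltn_mul_sub_codim m k : 1 < k -> k * (m - k) < m -> m <= k.+1.
Proof.
move=> k1 h; rewrite leqNgt; apply/negP=> km.
have [j e] : exists j, m = (k + j.+2)%N by exists (m - k.+2)%N; lia.
by move: h; rewrite e addKn; nia.
Qed.

(** Commuting with a transitive group, an element of [M] is determined by its value at one point. *)
Lemma semiregular_orb M X p : trans X -> X \subset 'C(M) -> #|orb M p| = #|M|.
Proof.
move=> tX /centsP cXM; apply: card_in_imset => a b aM bM /= e.
apply/permP=> q; have : q \in orb X p by rewrite tX inE.
case/imsetP=> x xX ->; rewrite -!permM (cXM x xX a aM) (cXM x xX b bM).
by rewrite !permM e.
Qed.

(** All [M]-orbits have [#|M|] points, and there are at least two. *)
Lemma semiregular_half M X :
  trans X -> X \subset 'C(M) -> ~ trans M -> #|M| + #|M| <= n.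
Proof.
move=> tX cX ntM; apply: contrapT => h; apply: ntM => p.
apply/eqP; rewrite eqEsubset subsetT; apply/subsetP => q _; apply: contraT => qp.
exfalso; apply: h; rewrite -{1}(semiregular_orb p tX cX) -(semiregular_orb q tX cX).
rewrite -cardsUI (_ : orb M p :&: orb M q = set0) ?cards0 ?addn0.
  by rewrite -[X in _ <= X]card_ord max_card.
by apply/setP=> r; rewrite !inE; apply/andP => -[/(orb_disjoint qp)/negP h /h].
Qed.

Lemma mulG_setT_C M T : M * T = [set: 'S_n] -> T * M = [set: 'S_n].
Proof.
move=> e; apply/setP=> s; rewrite inE.
have : s^-1 \in M * T by rewrite e inE.
by case/mulsgP=> m t mM tT es; rewrite -(invgK s) es invMg mem_mulg ?groupV.
Qed.

(** * Pairs of factorizations with centralising factors *)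

Section Factorization.
Hypothesis n4 : 3 < n.

(** The intersection of [M] and [T] centralises [M'] and [T'], hence all of S_n, and is trivial. *)
Lemma factor_card M T (M' T' : {group 'S_n}) :
  M * T = [set: 'S_n] -> M' * T' = [set: 'S_n] ->
  M' \subset 'C(M) -> T' \subset 'C(T) -> (#|M| * #|T|)%N = n`!.
Proof.
move=> MT MT' cM cT; rewrite mul_cardG MT cardsT card_Sn.
suff -> : M :&: T = 1 by rewrite cards1 muln1.
apply/trivgP; rewrite -(center_Sn n4) -MT' centM.
by rewrite setISS // centsC.
Qed.

(** Both [T] and [T'] have order at most n. A nontrivial [M]-orbit then misses at most one point, so
    [M'] also has order at most n, too small for n! = |M'||T'|. If [M] is trivial, n! = |T| is too
    large. *)
Lemma factor_trans_regular M T (M' T' : {group 'S_n}) :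
  M * T = [set: 'S_n] -> M' * T' = [set: 'S_n] ->
  M' \subset 'C(M) -> T' \subset 'C(T) -> trans T -> trans T' -> False.
Proof.
move=> MT MT' cM cT tT tT'.
have n0 : 0 < n by lia.
have Tn : #|T| <= n by apply: (card_trans_commute n0 tT'); rewrite centsC.
have Tn' : #|T'| <= n by apply: (card_trans_commute n0 tT).
have c1 := factor_card MT MT' cM cT.
have c2 : (#|M'| * #|T'|)%N = n`!.
  by apply: (factor_card MT' MT); rewrite centsC.
have fn : n`! = (n * (n.-1)`!)%N by case: n n0 => // k _; rewrite factS.
have fg := fact_gt_id n4.
have [/existsP[p pM]|/existsPn hM] := boolP [exists p, 1 < #|orb M p|].
  have := card_factor_orbit p MT; set k := #|_| => hk.
  have kn : n <= k.+1.
    by apply: ltn_mul_sub_codim pM (leq_trans hk Tn).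
  have := card_perm_commute_le cM kn.
  by rewrite fn in c2; nia.
have M1 : #|M| <= 1.
  rewrite -trivg_card_le1; apply/eqP/trivgP/subsetP=> m mM; rewrite inE; apply/eqP/permP=> p.
  rewrite perm1; have := hM p; rewrite -leqNgt => /card_le1_eqP h.
  by apply: h; rewrite ?orbM ?orb_refl.
by rewrite fn in c1; nia.
Qed.

(** For nontrivial [M], neither [M] nor [T'] is transitive by the preceding lemma. Both are
    semiregular, hence of order at most n/2, against n < |M| + |T'|. *)
Lemma factor_trans_semiregular M T (M' T' : {group 'S_n}) :
  M * T = [set: 'S_n] -> M' * T' = [set: 'S_n] ->
  M' \subset 'C(M) -> T' \subset 'C(T) -> trans T -> trans M' -> M :=: 1.
Proof.
move=> MT MT' cM cT tT tM'.
have [//|/trivgPn[m mM m1]] := eqVneq (M : {set _}) 1; exfalso.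
have ntT' : ~ trans T' by move=> h; exact: (factor_trans_regular MT MT' cM cT tT h).
have ntM : ~ trans M.
  move=> h; exact: (factor_trans_regular (mulG_setT_C MT) (mulG_setT_C MT') cT cM h tM').
have h1 := semiregular_half tM' cM ntM.
have h2 : #|T'| + #|T'| <= n by apply: (semiregular_half tT) => //; rewrite centsC.
have n0 : 0 < n by lia.
have eo := semiregular_orb (Ordinal n0) tM' cM.
have M1 : 1 < #|M| by rewrite cardG_gt1; apply/trivgPn; exists m.
rewrite -eo in M1.
have h3 := card_factor_centraliser cM MT' M1; rewrite eo in h3.
have arith a b : a + a <= n -> b + b <= n -> n < a + b -> False by lia.
exact: arith h1 h2 h3.
Qed.

Lemma factor_trivial M T (M' T' : {group 'S_n}) :
  M * T = [set: 'S_n] -> M' * T' = [set: 'S_n] ->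
  M' \subset 'C(M) -> T' \subset 'C(T) -> M :=: 1 \/ T :=: 1.
Proof.
move=> MT MT' cM cT; have n3 : 2 < n by lia.
have [tM|tT] := trans_of_factor n3 MT; have [tM'|tT'] := trans_of_factor n3 MT'.
- by case: (factor_trans_regular (mulG_setT_C MT) (mulG_setT_C MT') cT cM).
- right; exact: (factor_trans_semiregular (mulG_setT_C MT) (mulG_setT_C MT') cT cM).
- left; exact: (factor_trans_semiregular MT MT' cM cT).
- by case: (factor_trans_regular MT MT' cM cT).
Qed.

(** The intersection of [M] and [T] centralises A_n, so it is trivial. An even conjugator would lie
    in [M * T], hence in [M], giving T = M = 1. So [g] is odd, [M] consists of even elements, and
    [M * T] is exactly A_n. *)
Lemma alt_factor_conj_card M T (M' T' : {group 'S_n}) (g : 'S_n) :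
  'Alt_('I_n) \subset M * T -> 'Alt_('I_n) \subset M' * T' ->
  M' \subset 'C(M) -> T' \subset 'C(T) -> T :=: M :^ g ->
  (2 * (#|M| * #|M|))%N = n`!.
Proof.
move=> MT MT' cM cT eT.
have cap : M :&: T = 1.
  apply/trivgP; rewrite -(cent_Alt n4).
  apply: subset_trans (centS MT'); rewrite centM.
  by rewrite setISS // centsC.
have cTM : #|T| = #|M| by rewrite eT cardJg.
have ncase h : ~~ odd_perm h -> T :=: M :^ h -> False.
  rewrite -Alt_even => /(subsetP MT) /mulsgP[m t mM].
  move=> + eh e; rewrite e => /imsetP[m2 m2M et].
  have hM : h \in M.
    have e4 : m * h^-1 * m2 = 1.
      by apply: (mulIg h); rewrite mul1g [RHS]eh et /conjg !mulgA.
    have -> : h = m2 * m by apply: (mulgI (m * h^-1)); rewrite mulgKV mulgA e4 mul1g.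
    by rewrite groupM.
  have eTM : T :=: M by rewrite e conjGid.
  have M1 : M :=: 1 by rewrite -cap eTM setIid.
  have := subset_leq_card MT; rewrite eTM M1 mulg1 cards1.
  have := @card_Alt 'I_n; rewrite card_ord => /(_ _)%N h2 h3.
  have n1 : 1 < n by lia.
  have := h2 n1; have fn : n`! = (n * (n.-1)`!)%N by case: n n1 => // k _; rewrite factS.
  by have := fact_gt_id n4; rewrite fn; nia.
have [go|ge] := boolP (odd_perm g); last by case: (ncase g ge eT).
have Me m : m \in M -> ~~ odd_perm m.
  move=> mM; apply/negP=> om; apply: (ncase (m * g)).
    by rewrite odd_permM om go.
  by rewrite conjsgM (conjGid mM).
have MTe : M * T = 'Alt_('I_n).
  apply/eqP; rewrite eqEsubset MT andbT; apply/subsetP=> s /mulsgP[m t mM].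
  rewrite eT => /imsetP[m2 m2M ->] ->.
  by rewrite Alt_even odd_permM odd_permJ (negbTE (Me _ mM)) (negbTE (Me _ m2M)).
have := mul_cardG M T; rewrite MTe cap cards1 muln1 cTM => ->.
by have := @card_Alt 'I_n; rewrite card_ord => -> //; lia.
Qed.

(** Some factor is transitive, so |M'| is at most n, while 2|M'|^2 = n!. This fails by size for n >
    4, and for n = 4 because 12 is not a square. *)
Lemma alt_factor_conj_false M T (M' T' : {group 'S_n}) (g h : 'S_n) :
  'Alt_('I_n) \subset M * T -> 'Alt_('I_n) \subset M' * T' ->
  M' \subset 'C(M) -> T' \subset 'C(T) -> T :=: M :^ g -> T' :=: M' :^ h -> False.
Proof.
move=> MT MT' cM cT eT eT'.
have c1 : (2 * (#|M'| * #|M'|))%N = n`!.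
  by apply: (alt_factor_conj_card MT' MT _ _ eT'); rewrite centsC.
have n3 : 2 < n by lia.
have n0 : 0 < n by lia.
have cT1 : #|T'| = #|M'| by rewrite eT' cardJg.
have Mn : #|M'| <= n.
  have [tM|tT] := alt_factor_trans n3 MT; first exact: (card_trans_commute n0 tM cM).
  by rewrite -cT1; exact: (card_trans_commute n0 tT cT).
have fn : n`! = (n * (n.-1)`!)%N by case: n n0 => // k _; rewrite factS.
have [n5|n5] := leqP n 4.
  have en : n = 4%N by lia.
  move: c1 Mn; move: #|M'| => k; rewrite [in n`!]en [in _ <= n]en.
  by case: k => [|[|[|[|[|k]]]]].
have : 2 * n < (n.-1)`!.
  case: (n) n5 => [|[|[|[|[|k]]]]] // _; elim: k => [//|k IH].
  by rewrite factS /=; move: IH => /=; set x := _`!; nia.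
by rewrite fn in c1; nia.
Qed.
End Factorization.
End PermGroups.

(** * Maps permuting the cells *)

Section Cells.
Local Open Scope group_scope.
Variable n : nat.
Implicit Types (s t : 'S_n) (i j k l : 'I_n).

Definition cell i j : {set 'S_n} := [set s : 'S_n | s i == j].

Lemma leq_card_cell i j k l : #|cell i j| <= #|cell k l|.
Proof.
rewrite -(card_imset (cell i j) (mulgI (tperm i k))).
rewrite -(card_imset _ (mulIg (tperm j l))).
apply/subset_leq_card/subsetP=> _ /imsetP[_ /imsetP[s + ->] ->].
by rewrite !inE => /eqP e; rewrite !permM tpermR e tpermL.
Qed.

(** The third value [z] needs n > 2: for n = 2 the two diagonal cells coincide. *)
Lemma cell_neq i j k l : 2 < n -> cell i j = cell k l -> i = k /\ j = l.
Proof.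
move=> n3 e.
have e2 (s : 'S_n) : (s i == j) = (s k == l) by move/setP/(_ s): e; rewrite !inE.
have [eik|nik] := eqVneq i k.
  move: (e2 (tperm i j)); rewrite tpermL eqxx -eik tpermL => /esym/eqP ->.
  by [].
exfalso; have [z zj zl] : exists2 z : 'I_n, j != z & l != z.
  have : 0 < #|~: [set j; l]|.
    by have := cardsC [set j; l]; rewrite card_ord cards2; lia.
  by case/card_gt0P=> c; rewrite !inE negb_or => /andP[h1 h2]; exists c; rewrite eq_sym.
have [s si sk] := exists_perm2 nik zj.
by move: (e2 s); rewrite si sk eqxx eq_sym (negbTE zl).
Qed.

(** A clique of the rook graph lies on one line: two positions in different rows share a column,
    which then contains every other position. *)
Lemma clique_line (r c : 'I_n -> 'I_n) :
  (forall j j', j != j' -> r j = r j' \/ c j = c j') ->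
  (forall j j', r j = r j') \/ (forall j j', c j = c j').
Proof.
move=> adj; have [h|h] := pselect (forall j j', r j = r j'); first by left.
right; have [j0 [j1 nr]] : exists j0 j1, r j0 <> r j1.
  apply: contrapT => h2; apply: h => j j'; apply: contrapT => h3; apply: h2.
  by exists j, j'.
suff h3 j : c j = c j0 by move=> j j'; rewrite !h3.
have [-> //|nj] := eqVneq j j0.
have c01 : c j0 = c j1.
  by case: (adj j0 j1) => //; apply/eqP=> e; apply: nr; rewrite e.
case: (adj _ _ nj) => // er; rewrite c01.
case: (adj j j1) => //; last by rewrite er.
by apply/eqP => ej; apply: nr; rewrite -er ej.
Qed.

Lemma inj_ord_surj (f : 'I_n -> 'I_n) : injective f -> forall y, exists x, f x = y.
Proof. by move=> fi y; exists (invF fi y); rewrite f_invF. Qed.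

(** * Maps permuting cells as automorphisms of the rook graph *)

Section CellMaps.
Variables (alpha : 'S_n -> 'S_n) (r c : 'I_n -> 'I_n -> 'I_n).
Hypotheses (n3 : 2 < n) (alpha_inj : injective alpha).
Hypothesis alphaE : forall s i j, (alpha s i == j) = (s (r i j) == c i j).

Lemma cell_map_inj i j k l : r i j = r k l -> c i j = c k l -> i = k /\ j = l.
Proof.
move=> er ec; apply: cell_neq => //; apply/setP=> s; rewrite !inE.
have -> : s = alpha (invF alpha_inj s) by rewrite f_invF.
by rewrite !alphaE er ec.
Qed.

(** The hypothesis makes the two cells disjoint; if both indices of their preimages differed, some
    [s] would lie in both preimages. *)
Lemma cell_map_adj i j k l :
  (i == k) != (j == l) -> r i j = r k l \/ c i j = c k l.
Proof.
move=> h; have [|nr] := eqVneq (r i j) (r k l); first by left.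
have [|nc] := eqVneq (c i j) (c k l); first by right.
have [s s1 s2] := exists_perm2 nr nc.
have := alphaE s i j; have := alphaE s k l; rewrite s1 s2 !eqxx => /eqP e1 /eqP e2.
exfalso; move: h; rewrite -e1 -e2.
have [e|ne] := eqVneq i k; first by rewrite e eqxx.
by rewrite (inj_eq perm_inj) (negbTE ne).
Qed.

(** If one row goes to a row then all rows do and columns go to columns, so the index map is a
    product of two permutations. *)
Lemma cell_map_of_row i0 : (forall j j', r i0 j = r i0 j') ->
  exists a b, forall s, alpha s = a * s * b.
Proof.
move=> row0.
have rowsurj i : (forall j j', r i j = r i j') -> forall y, exists j, c i j = y.
  move=> h; apply: inj_ord_surj => j j' e.
  by have [] := cell_map_inj (h j j') e.
have rows i : forall j j', r i j = r i j'.
  have [j|//|h] := @clique_line (r i) (c i).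
    by move=> j' nj; apply: cell_map_adj; rewrite eqxx (negbTE nj).
  have [-> //|ni] := eqVneq i i0; exfalso.
  (* A row sent to a column would share a position with the image of row [i0]. *)
  have [j ej] := rowsurj i0 row0 (c i i0).
  have [j' ej'] : exists j', r i j' = r i0 i0.
    apply: inj_ord_surj => k k' e; by have [] := cell_map_inj e (h k k').
  have [e _] : i0 = i /\ j = j'.
    by apply: cell_map_inj; rewrite ?ej' ?ej //; apply: h.
  by rewrite e eqxx in ni.
pose a i := r i i0.
have ra i j : r i j = a i by exact: rows.
have a_inj : injective a.
  move=> i k e; have [j ej] := rowsurj i (rows i) (c k i0).
  by have [] : i = k /\ j = i0 by apply: cell_map_inj; rewrite ?ra.
pose b j := c i0 j.
have cb i j : c i j = b j.
  have [k k'|h|h] := @clique_line (r ^~ j) (c ^~ j).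
  - by move=> nk; apply: cell_map_adj; rewrite eqxx (negbTE nk).
  - have [k nk] : exists k, k != i.
      have : 0 < #|~: [set i]|.
        by have := cardsC [set i]; rewrite card_ord cards1; lia.
      by case/card_gt0P=> k; rewrite !inE => ?; exists k.
    by move: (h k i); rewrite !ra => /a_inj ek; rewrite ek eqxx in nk.
  - exact: h.
have b_inj : injective b.
  by move=> j j' e; have [] : i0 = i0 /\ j = j' by apply: cell_map_inj; rewrite ?ra.
exists (perm a_inj), (perm b_inj)^-1 => s; apply/permP=> i.
rewrite !permM [perm a_inj i]permE; apply: (canRL (permK _)); rewrite permE.
by apply/eqP; rewrite eq_sym -(cb i) -(ra i (alpha s i)) -alphaE.
Qed.
End CellMaps.

(** All cells have the same size, so an inclusion between a cell and a preimage of a cell is an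
    equality. *)
Lemma cell_map_eq (alpha : 'S_n -> 'S_n) i j k l : injective alpha ->
  (forall s, s k = l -> alpha s i = j) -> forall s, (alpha s i == j) = (s k == l).
Proof.
move=> ai h s; have sub : cell k l \subset alpha @^-1: cell i j.
  by apply/subsetP=> t; rewrite !inE => /eqP /h ->.
have : cell k l == alpha @^-1: cell i j.
  by rewrite eqEcard sub /= card_preimset // leq_card_cell.
by move=> /eqP/setP/(_ s); rewrite !inE.
Qed.

Lemma cell_map_form (alpha : 'S_n -> 'S_n) : 2 < n -> injective alpha ->
  (forall i j, exists k l, forall s, s k = l -> alpha s i = j) ->
  exists a b, (forall s, alpha s = a * s * b) \/ (forall s, alpha s = a * s^-1 * b).
Proof.
move=> n3 ai h.
have [rc rcP] : {rc : 'I_n -> 'I_n -> 'I_n * 'I_n &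
    forall i j s, s (rc i j).1 = (rc i j).2 -> alpha s i = j}.
  have h2 i : {f : 'I_n -> 'I_n * 'I_n & forall j s, s (f j).1 = (f j).2 -> alpha s i = j}.
    apply: (@choice _ _ (fun j (p : 'I_n * 'I_n) => forall s, s p.1 = p.2 -> alpha s i = j)) => j.
    by have [k [l hs]] := h i j; exists (k, l).
  by exists (fun i => projT1 (h2 i)) => i; exact: (projT2 (h2 i)).
pose r i j := (rc i j).1; pose c i j := (rc i j).2.
have alphaE s i j : (alpha s i == j) = (s (r i j) == c i j).
  by apply: cell_map_eq => // t /rcP.
have i0 : 'I_n by exists 0%N; lia.
have [j|h1|h1] := @clique_line (r i0) (c i0).
- by move=> j' nj; apply: (cell_map_adj alphaE); rewrite eqxx (negbTE nj).
- by have [a [b e]] := cell_map_of_row n3 ai alphaE h1; exists a, b; left.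
(* If a row goes to a column, inverting the argument exchanges [r] and [c]. *)
- have [|s i j|a [b e]] := @cell_map_of_row (fun s => alpha s^-1) c r n3 _ _ i0 h1.
  + by move=> s t /ai /invg_inj.
  + by rewrite alphaE (can2_eq (permKV s) (permK s)) eq_sym.
  + by exists a, b; right=> s; rewrite -e invgK.
Qed.
End Cells.

(** * Commuting transitive families of maps on S_n *)

Section RegularFamilies.
Local Open Scope group_scope.
Variables (n : nat) (I : finType).
Implicit Types (s t a b c e : 'S_n) (x y z : I).

Definition straight (alpha : 'S_n -> 'S_n) a b := forall s, alpha s = a * s * b.
Definition twisted (alpha : 'S_n -> 'S_n) a b := forall s, alpha s = a * s^-1 * b.

Lemma center_Sn_trivial : 2 < n -> forall z : 'S_n, (forall s, z * s = s * z) -> z = 1.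
Proof.
move=> n3 z cz; apply/permP=> i; rewrite perm1; apply/eqP/contraT => nz.
have : 0 < #|~: [set i; z i]|.
  by have := cardsC [set i; z i]; rewrite card_ord cards2; lia.
case/card_gt0P=> k; rewrite !inE negb_or => /andP[ki kz].
have := congr1 (fun t : 'S_n => t i) (cz (tperm i k)).
rewrite !permM tpermL tpermD // 1?eq_sym // => /perm_inj e.
by rewrite e eqxx in ki.
Qed.

Lemma straight_uniq a b a' b' : 2 < n ->
  (forall s, a * s * b = a' * s * b') -> a = a' /\ b = b'.
Proof.
move=> n3 h; have e1 := h 1; rewrite !mulg1 in e1.
have z1 : a'^-1 * a = 1.
  apply: (center_Sn_trivial n3) => s; apply: (mulIg b); rewrite -!mulgA [a * (s * b)]mulgA h.
  by rewrite e1 -!mulgA mulKg mulKg.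
have ea : a = a' by apply: (mulgI a'^-1); rewrite z1 mulVg.
by split=> //; apply: (mulgI a); rewrite e1 ea.
Qed.

Lemma straight_straight_comm alpha beta a b c e : 2 < n ->
  straight alpha a b -> straight beta c e ->
  (forall s, alpha (beta s) = beta (alpha s)) -> commute a c /\ commute b e.
Proof.
move=> n3 ha hb h; have [|e1 e2] := @straight_uniq (a * c) (e * b) (c * a) (b * e) n3.
  by move=> s; have := h s; rewrite !ha !hb !mulgA.
by [].
Qed.

(** Comparing a c s^-1 e b with c b^-1 s^-1 a^-1 e yields a c = c b^-1. *)
Lemma straight_twisted_comm alpha beta a b c e : 2 < n ->
  straight alpha a b -> twisted beta c e ->
  (forall s, alpha (beta s) = beta (alpha s)) -> b^-1 = a ^ c.
Proof.
move=> n3 ha hb h.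
have [|e1 e2] := @straight_uniq (a * c) (e * b) (c * b^-1) (a^-1 * e) n3.
  by move=> s; have := h s^-1; rewrite !ha !hb invgK !invMg invgK !mulgA => ->.
by rewrite /conjg e1 mulKg.
Qed.

Section Family.
Variable A : I -> 'S_n -> 'S_n.

Definition leftpart := [set a : 'S_n | [exists x, exists b, forall s, A x s == a * s * b]].
Definition rightpart := [set b : 'S_n | [exists x, exists a, forall s, A x s == a * s * b]].

Lemma leftpartP a : reflect (exists x b, straight (A x) a b) (a \in leftpart).
Proof.
rewrite inE; apply: (iffP existsP) => -[x].
  by move=> /existsP[b /forallP h]; exists x, b => s; apply/eqP.
by move=> [b h]; exists x; apply/existsP; exists b; apply/forallP => s; apply/eqP.
Qed.

Lemma rightpartP b : reflect (exists x a, straight (A x) a b) (b \in rightpart).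
Proof.
rewrite inE; apply: (iffP existsP) => -[x].
  by move=> /existsP[a /forallP h]; exists x, a => s; apply/eqP.
by move=> [a h]; exists x; apply/existsP; exists a; apply/forallP => s; apply/eqP.
Qed.

(** Models the translations of [G] carried over to S_n, with transitivity stated at 1. *)
Definition regular_family :=
  [/\ forall s, exists x, A x 1 = s, exists x, forall s, A x s = s,
      forall x y, exists z, forall s, A z s = A x (A y s)
    & forall x, exists a b, straight (A x) a b \/ twisted (A x) a b].

Hypothesis regA : regular_family.

Lemma group_set_leftpart : group_set leftpart.
Proof.
case: regA => _ [x0 h0] clA _; apply/group_setP; split.
  by apply/leftpartP; exists x0, 1 => s; rewrite h0 mul1g mulg1.
move=> a a' /leftpartP[x [b h]] /leftpartP[x' [b' h']].
have [z hz] := clA x x'; apply/leftpartP; exists z, (b' * b) => s.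
by rewrite hz h h' !mulgA.
Qed.

Lemma group_set_rightpart : group_set rightpart.
Proof.
case: regA => _ [x0 h0] clA _; apply/group_setP; split.
  by apply/rightpartP; exists x0, 1 => s; rewrite h0 mul1g mulg1.
move=> b b' /rightpartP[x [a h]] /rightpartP[x' [a' h']].
have [z hz] := clA x' x; apply/rightpartP; exists z, (a' * a) => s.
by rewrite hz h' h !mulgA.
Qed.

Definition leftgroup := Group group_set_leftpart.
Definition rightgroup := Group group_set_rightpart.

Lemma regular_straight_factor :
  (forall x a b, ~ twisted (A x) a b) -> leftgroup * rightgroup = [set: 'S_n].
Proof.
move=> nt; case: regA => regx _ _ form; apply/setP=> s; rewrite inE.
have [x <-] := regx s; have [a [b [h|/nt//]]] := form x.
rewrite h mulg1 mem_mulg //; first by apply/leftpartP; exists x, b.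
by apply/rightpartP; exists x, a.
Qed.

(* Composing with one twisted member exchanges straight and twisted members,
   so at least half of the family is straight. *)
Lemma regular_twisted_factor x0 a0 b0 : twisted (A x0) a0 b0 ->
  (forall x a b, straight (A x) a b -> ~~ odd_perm (A x 1)) ->
  'Alt_('I_n) \subset leftgroup * rightgroup.
Proof.
move=> h0 even; case: regA => regx _ clA form.
pose E := [set s : 'S_n | [exists x, exists a, exists b, (A x 1 == s) &&
   [forall s, A x s == a * s * b]]].
have EP s : reflect (exists x a b, A x 1 = s /\ straight (A x) a b) (s \in E).
  rewrite inE; apply: (iffP existsP) => -[x].
    move=> /existsP[a /existsP[b /andP[/eqP e /forallP h]]].
    by exists x, a, b; split=> // t; apply/eqP.
  move=> [a [b [e h]]]; exists x; apply/existsP; exists a; apply/existsP; exists b.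
  by rewrite e eqxx; apply/forallP=> t; apply/eqP.
have EA : E \subset 'Alt_('I_n).
  by apply/subsetP=> s /EP[x [a [b [<- h]]]]; rewrite Alt_even (even x a b).
have EC : #|~: E| <= #|E|.
  have inj0 : injective (A x0) by move=> s t; rewrite !h0 => /mulIg/mulgI/invg_inj.
  rewrite -(card_imset _ inj0); apply/subset_leq_card/subsetP=> _ /imsetP[s sE ->].
  have [x ex] := regx s; have [z hz] := clA x0 x.
  have [a [b [h|h]]] := form x.
    by move: sE; rewrite inE => /negP[]; apply/EP; exists x, a, b.
  apply/EP; exists z, (a0 * b^-1), (a^-1 * b0); split; first by rewrite hz ex.
  by move=> t; rewrite hz h0 h !invMg !invgK !mulgA.
have -> : 'Alt_('I_n) = E.
  apply/esym/eqP; rewrite eqEcard EA /=.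
  (* The formula |A_n| = n!/2 needs n > 1. *)
  have [n1|n1] := leqP n 1.
    apply: leq_trans (max_card _) _; rewrite card_Sn.
    have -> : n`! = 1%N by case: (n) n1 => [|[]].
    apply/card_gt0P; exists 1; apply/EP; case: regA => _ [x hx] _ _.
    by exists x, 1, 1; split=> [|s]; rewrite hx // mulg1 mul1g.
  have := @card_Alt 'I_n; rewrite card_ord => /(_ n1) e1.
  have e2 := cardsC E; rewrite card_Sn -e1 in e2.
  have arith k l m : k + l = (2 * m)%N -> l <= k -> m <= k by lia.
  exact: arith e2 EC.
apply/subsetP=> s /EP[x [a [b [<- h]]]].
rewrite h mulg1 mem_mulg //; first by apply/leftpartP; exists x, b.
by apply/rightpartP; exists x, a.
Qed.
End Family.

Section TwoFamilies.
Variables A B : I -> 'S_n -> 'S_n.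
Hypotheses (n3 : 2 < n) (regA : regular_family A) (regB : regular_family B).
Hypothesis AB : forall x y s, A x (B y s) = B y (A x s).

Lemma leftgroup_cent : leftgroup regB \subset 'C(leftgroup regA).
Proof.
apply/centsP=> c /leftpartP[y [e hy]] a /leftpartP[x [b hx]].
by have [] := straight_straight_comm n3 hy hx (fun s => esym (AB x y s)).
Qed.

Lemma rightgroup_cent : rightgroup regB \subset 'C(rightgroup regA).
Proof.
apply/centsP=> e /rightpartP[y [c hy]] b /rightpartP[x [a hx]].
by have [] := straight_straight_comm n3 hy hx (fun s => esym (AB x y s)).
Qed.

(** Here b^-1 is conjugate to a, so [a * b] is even. *)
Lemma twisted_even y c e : twisted (B y) c e ->
  forall x a b, straight (A x) a b -> ~~ odd_perm (A x 1).
Proof.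
move=> hy x a b hx; have e1 := straight_twisted_comm n3 hx hy (AB x y).
rewrite hx mulg1 odd_permM -[b]invgK odd_permV e1 odd_permJ.
by case: (odd_perm a).
Qed.

Lemma twisted_conj y c e : twisted (B y) c e ->
  rightgroup regA :=: leftgroup regA :^ c.
Proof.
move=> hy; apply/eqP; rewrite eqEsubset; apply/andP; split; apply/subsetP.
  move=> b bR; have /rightpartP[x [a hx]] := bR.
  have e1 := straight_twisted_comm n3 hx hy (AB x y).
  by rewrite -[b]invgK groupV e1 memJ_conjg; apply/leftpartP; exists x, b.
move=> _ /imsetP[a aL ->]; have /leftpartP[x [b hx]] := aL.
rewrite -(straight_twisted_comm n3 hx hy (AB x y)) groupV.
by apply/rightpartP; exists x, a.
Qed.

(** Otherwise all members of [A] are straight with even value at 1, yet some value is a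
    transposition. *)
Lemma exists_twisted y c e : twisted (B y) c e ->
  exists x a b, twisted (A x) a b.
Proof.
move=> hy; apply: contrapT => nt.
case: (regA) => regx _ _ form.
have [x ex] := regx (tperm (Ordinal (ltn_trans (ltnSn 0) (ltnW n3))) (Ordinal (ltnW n3))).
have [a [b [h|h]]] := form x; last by apply: nt; exists x, a, b.
by have := twisted_even hy h; rewrite ex odd_tperm.
Qed.
End TwoFamilies.

(** Twisted members would occur in both families and give products covering A_n with conjugate
    factors, which is impossible. Without them the left or the right group of [A] is trivial. *)
Theorem commuting_regular_families (A B : I -> 'S_n -> 'S_n) :
  3 < n -> regular_family A -> regular_family B ->
  (forall x y s, A x (B y s) = B y (A x s)) ->
  (forall x s, A x s = A x 1 * s) \/ (forall x s, A x s = s * A x 1).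
Proof.
move=> n4 regA regB AB; have n3 : 2 < n by lia.
have BA x y s : B x (A y s) = A y (B x s) by rewrite AB.
have cl := leftgroup_cent n3 regA regB AB.
have cr := rightgroup_cent n3 regA regB AB.
have [[y [c [e hy]]]|nt] := pselect (exists y c e, twisted (B y) c e).
  have [x [a [b hx]]] := exists_twisted n3 regA AB hy.
  have fA := regular_twisted_factor regA hx (twisted_even n3 AB hy).
  have fB := regular_twisted_factor regB hy (twisted_even n3 BA hx).
  case: (alt_factor_conj_false n4 fA fB cl cr (twisted_conj n3 regA AB hy) (twisted_conj n3 regB BA hx)).
have ntA x a b : ~ twisted (A x) a b.
  move=> hx; apply: nt; exact: (exists_twisted n3 regB BA hx).
have fA := regular_straight_factor regA ntA.
have fB : leftgroup regB * rightgroup regB = [set: 'S_n].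
  by apply: regular_straight_factor => y c e hy; apply: nt; exists y, c, e.
case: (regA) => _ _ _ form.
have [L1|R1] := factor_trivial n4 fA fB cl cr; [right|left] => x s.
  have [a [b [h|/ntA //]]] := form x.
  have : a \in leftgroup regA by apply/leftpartP; exists x, b.
  by rewrite L1 inE => /eqP a1; rewrite !h a1 !mul1g.
have [a [b [h|/ntA //]]] := form x.
have : b \in rightgroup regA by apply/rightpartP; exists x, a.
by rewrite R1 inE => /eqP b1; rewrite !h b1 !mulg1.
Qed.
End RegularFamilies.

(** * Groups of order six *)

Section OrderSix.
Local Open Scope group_scope.

(** The subgroup generated by [x] and [y] has even order dividing 6 and different from 2, so it is
    [G]. *)
Lemma order6_dihedral (gT : finGroupType) (G : {group gT}) (x y : gT) :
  #|G| = 6 -> x \in G -> y \in G -> #[x] = 2 -> #[y] = 2 -> x != y -> G \isog 'D_6.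
Proof.
move=> oG xG yG ox oy nxy.
have sub : <<[set x; y]>> \subset G.
  by rewrite gen_subG; apply/subsetP=> z /set2P[] ->.
have d6 : #|<<[set x; y]>>| %| 6 by rewrite -oG cardSg.
have xi : x \in <<[set x; y]>> by rewrite mem_gen // set21.
have yi : y \in <<[set x; y]>> by rewrite mem_gen // set22.
have d2 : 2 %| #|<<[set x; y]>>| by rewrite -ox order_dvdG.
have n2 : #|<<[set x; y]>>| != 2.
  apply: contra nxy => /eqP e.
  have ex : <[x]> = <<[set x; y]>>.
    by apply/eqP; rewrite eqEcard cycle_subG xi -orderE ox e leqnn.
  move: yi; rewrite -ex => /cycleP[k]; rewrite -(expg_mod_order x) ox modn2.
  case: (odd k); rewrite ?expg1 ?expg0 => ey; first by rewrite ey.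
  by move: oy; rewrite ey order1.
have e6 : #|<<[set x; y]>>| = 6.
  move: d6 d2 n2; move: #|_| => k k6; have : k <= 6 by apply: dvdn_leq.
  by case: k k6 => [|[|[|[|[|[|[|k]]]]]]].
have eG : <<[set x; y]>> = G by apply/eqP; rewrite eqEcard sub e6 oG.
by have := involutions_gen_dihedral ox oy nxy; rewrite /= e6 eG.
Qed.

Lemma order6_noncyclic (gT : finGroupType) (G : {group gT}) :
  #|G| = 6 -> ~~ cyclic G -> G \isog 'D_6.
Proof.
move=> oG ncG.
have [x xG ox] : {x | x \in G & #[x] = 3} by apply: Cauchy; rewrite ?oG.
have [y yG oy] : {y | y \in G & #[y] = 2} by apply: Cauchy; rewrite ?oG.
(* If [x] and [y] commuted, [x * y] would have order 6. *)
have nc : y ^ x != y.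
  apply: contra ncG => /eqP e.
  have cxy : commute x y by rewrite /commute [RHS]conjgC e.
  apply/cyclicP; exists (x * y); apply/esym/eqP.
  by rewrite eqEcard cycle_subG groupM //= oG -orderE orderM // ox oy.
by apply: (@order6_dihedral _ G (y ^ x) y); rewrite ?orderJ // groupJ.
Qed.

Lemma S3_dihedral : [set: 'S_3] \isog 'D_6.
Proof.
pose i0 : 'I_3 := inord 0; pose i1 : 'I_3 := inord 1; pose i2 : 'I_3 := inord 2.
have ne k l : k != l -> k < 3 -> l < 3 -> (inord k : 'I_3) != inord l.
  by move=> nkl k3 l3; rewrite -val_eqE /= !inordK.
have otp (i j : 'I_3) : i != j -> #[tperm i j] = 2.
  move=> nij; apply: nt_prime_order => //; first by rewrite expgS expg1 tperm2.
  by apply: contra nij => /eqP e; rewrite -(tpermL i j) e perm1.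
apply: (@order6_dihedral _ _ (tperm i0 i1) (tperm i1 i2)); rewrite ?inE ?otp ?ne //.
  by rewrite cardsT card_Sn.
apply: contra (ne 0 2 isT isT isT) => /eqP/(congr1 (fun s : 'S_3 => s i1)).
by rewrite tpermR tpermL => e; apply/eqP.
Qed.
End OrderSix.

(** * Parity and cells in S_3 *)

Section S3.
Local Open Scope group_scope.
Implicit Types (s t : 'S_3) (i j k : 'I_3).

Lemma ord3_cover i j k : i != j -> i != k -> j != k -> forall l, [\/ l = i, l = j | l = k].
Proof.
move=> ij ik jk l.
have : l \in [set i; j; k].
  suff -> : [set i; j; k] = [set: 'I_3] by rewrite inE.
  apply/eqP; rewrite eqEcard subsetT cardsT card_ord /=.
  by rewrite setUC cardsU1 !inE negb_or eq_sym ik eq_sym jk cards2 ij.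
by rewrite !inE -orbA => /or3P[]/eqP; [constructor 1|constructor 2|constructor 3].
Qed.

Lemma ord3_others i : exists j k, [/\ i != j, i != k & j != k].
Proof.
have : 1 < #|~: [set i]| by have := cardsC [set i]; rewrite card_ord cards1; lia.
case/card_gt1P=> j [k [+ + njk]]; rewrite !inE => ji ki.
by exists j, k; split=> //; rewrite eq_sym.
Qed.

Lemma S3_fix_even s i : s i = i -> ~~ odd_perm s -> s = 1.
Proof.
move=> si; have [j [k [ij ik jk]]] := ord3_others i.
have nsi l : i != l -> s l != i by move=> il; rewrite -[X in _ != X]si (inj_eq perm_inj) eq_sym.
have [ej|ej|ej] := ord3_cover ij ik jk (s j).
- by have := nsi j ij; rewrite ej eqxx.
- have ek : s k = k.
    have [ek|ek|//] := ord3_cover ij ik jk (s k).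
      by have := nsi k ik; rewrite ek eqxx.
    by move: jk; rewrite -(inj_eq (@perm_inj _ s)) ej ek eqxx.
  by move=> _; apply/permP=> l; rewrite perm1; have [->|->|->] := ord3_cover ij ik jk l.
- have ek : s k = j.
    have [ek|//|ek] := ord3_cover ij ik jk (s k).
      by have := nsi k ik; rewrite ek eqxx.
    by move: jk; rewrite -(inj_eq (@perm_inj _ s)) ej ek eqxx.
  have -> : s = tperm j k.
    apply/permP=> l; have [->|->|->] := ord3_cover ij ik jk l.
    + by rewrite si tpermD // eq_sym.
    + by rewrite tpermL.
    + by rewrite tpermR.
  by rewrite odd_tperm jk.
Qed.

Lemma S3_odd_fix s : odd_perm s -> exists i, s i = i.
Proof.
move=> os; pose i : 'I_3 := ord0; have [|ni] := eqVneq (s i) i; first by exists i.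
have e : s * tperm i (s i) = 1.
  apply: (@S3_fix_even _ i); first by rewrite permM tpermR.
  by rewrite odd_permM os odd_tperm eq_sym ni.
have [k] : exists k, k \in ~: [set i; s i].
  by apply/card_gt0P; have := cardsC [set i; s i]; rewrite card_ord cards2; lia.
rewrite !inE negb_or => /andP[k1 k2]; exists k.
have -> : s = tperm i (s i) by apply: (mulIg (tperm i (s i))); rewrite e tperm2.
by rewrite tpermD // eq_sym.
Qed.

Lemma S3_agree_eq s t i : s i = t i -> odd_perm s = odd_perm t -> s = t.
Proof.
move=> e o; apply: (mulIg t^-1); rewrite mulgV; apply: (@S3_fix_even _ i).
  by rewrite permM e permK.
by rewrite odd_permM odd_permV o addbb.
Qed.

Lemma S3_agree s t : odd_perm s != odd_perm t -> exists i, s i = t i.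
Proof.
move=> o; have [|i e] := @S3_odd_fix (s * t^-1).
  by rewrite odd_permM odd_permV; move: o; do 2!case: odd_perm.
by exists i; rewrite -[in RHS]e permM permKV.
Qed.

(** Here s^3 = 1, so s is the square of s^2. *)
Lemma S3_even_square s : ~~ odd_perm s -> exists t, s = t * t.
Proof.
rewrite -Alt_even => sA; exists (s * s).
have := @card_Alt 'I_3; rewrite card_ord => /(_ isT) c.
have c3 : #|'Alt_('I_3)| = 3 by apply/eqP; rewrite -(eqn_pmul2l (isT : 0 < 2)) c.
have := expg_cardG sA; rewrite c3 => e.
by rewrite !mulgA -[s * s * s]mulgA -[s * (s * s)](expgS s 2) e mul1g.
Qed.

(** A cell of S_3 consists of one even and one odd permutation, and any such pair agrees at a point,
    hence forms a cell. *)
Lemma S3_parity_cells (alpha : 'S_3 -> 'S_3) : injective alpha ->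
  (forall s, odd_perm (alpha s) = odd_perm s) ->
  forall i j, exists k l, forall s, (alpha s i == j) = (s k == l).
Proof.
move=> ai pa i j.
(* The cell of [i] and [j] consists of [tperm i j] and [tperm i j * c]. *)
have [c hc] : exists c : 'S_3, [/\ c j = j & odd_perm c].
  have [p [q [jp jq pq]]] := ord3_others j; exists (tperm p q).
  by rewrite odd_tperm pq tpermD // eq_sym.
have sur t : exists s, alpha s = t by exists (invF ai t); rewrite f_invF.
have [s1 e1] := sur (tperm i j); have [s2 e2] := sur (tperm i j * c).
have [|k ek] := @S3_agree s1 s2.
  by rewrite -(pa s1) -(pa s2) e1 e2 odd_permM (proj2 hc); case: odd_perm.
exists k, (s1 k); apply: cell_map_eq => // s es.
have [o|o] := eqVneq (odd_perm s) (odd_perm s1).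
  by rewrite (S3_agree_eq es o) e1 tpermL.
have o2 : odd_perm s = odd_perm s2.
  have : odd_perm s1 != odd_perm s2.
    by rewrite -(pa s1) -(pa s2) e1 e2 odd_permM (proj2 hc); case: odd_perm.
  by move: o; do 3!case: odd_perm.
by rewrite (@S3_agree_eq s s2 k) ?e2 ?es // permM tpermL (proj1 hc).
Qed.
End S3.

(** * Hall's theorem *)

Section Hall.
Variables (A B : finType).
Implicit Types (X : {set A}) (r : A -> {set B}).

Definition nbh r X : {set B} := \bigcup_(a in X) r a.

Lemma nbhP r X b : reflect (exists2 a, a \in X & b \in r a) (b \in nbh r X).
Proof. exact: bigcupP. Qed.

Lemma nbhU r X Y : nbh r (X :|: Y) = nbh r X :|: nbh r Y.
Proof. by rewrite /nbh bigcup_setU. Qed.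

(** Induction on |X|, by whether some proper nonempty subset is tight, that is, has as many
    neighbours as elements. [b0] is the value used for empty [X]. *)
Theorem hall (b0 : B) r X : (forall Y : {set A}, Y \subset X -> #|Y| <= #|nbh r Y|) ->
  exists f : A -> B, {in X &, injective f} /\ {in X, forall a, f a \in r a}.
Proof.
move: {2}#|X|.+1 (ltnSn #|X|) => m; elim: m => // m IH in r X *.
rewrite ltnS => Xm hallX.
have [->|[a aX]] := set_0Vmem X.
  by exists (fun=> b0); split=> a; rewrite inE.
have [/existsP[Y /and4P[YX Y0 YnX /eqP cY]]|/existsPn slack] :=
  boolP [exists Y : {set A}, [&& Y \subset X, Y != set0, Y != X & #|nbh r Y| == #|Y|]].
  (* Tight proper subset Y: match it first, and the rest outside its neighbourhood. *)
  have YltX : #|Y| < #|X| by rewrite proper_card // properEneq YnX YX.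
  have [|f1 [inj1 mem1]] := IH r Y (leq_trans YltX Xm).
    by move=> Z ZY; apply: hallX; apply: subset_trans YX.
  pose r2 c := r c :\: nbh r Y.
  have [||f2 [inj2 mem2]] := IH r2 (X :\: Y).
  - apply: leq_trans Xm; rewrite -(cardsID Y X) (setIidPr YX).
    by rewrite -[X in X < _]add0n ltn_add2r card_gt0.
  - move=> Z ZXY; have ZX : Z \subset X by apply: subset_trans ZXY (subsetDl _ _).
    have dis : [disjoint Z & Y].
      by move: ZXY; rewrite subsetD => /andP[].
    (* Hall's condition for [Z :|: Y] minus the equality for [Y] is the condition for [Z] under
       [r2]. *)
    have := hallX (Z :|: Y); rewrite subUset ZX YX => /(_ isT).
    rewrite cardsU (_ : Z :&: Y = set0) ?cards0 ?subn0; last first.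
      by apply/eqP; rewrite setI_eq0.
    rewrite nbhU => h.
    have -> : nbh r2 Z = nbh r Z :\: nbh r Y.
      apply/setP=> b; rewrite inE; apply/nbhP/andP=> [[c cZ]|[bY /nbhP[c cZ bc]]].
        by rewrite inE => /andP[-> bc]; split=> //; apply/nbhP; exists c.
      by exists c; rewrite // inE bY.
    have e1 := cardsUI (nbh r Z) (nbh r Y); have e2 := cardsID (nbh r Y) (nbh r Z).
    have arith z y u i D N NY : z + y <= u -> u + i = N + NY -> i + D = N -> NY = y -> z <= D.
      by lia.
    exact: arith h e1 e2 cY.
  exists (fun c => if c \in Y then f1 c else f2 c); split=> [c e cX eX|c cX].
    have n12 p q : p \in X -> p \in Y -> q \in X -> q \notin Y -> f1 p <> f2 q.
      move=> pX pY qX qY epq; have := mem2 q; rewrite !inE qX qY => /(_ isT)/andP[/negP + _].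
      by apply; rewrite -epq; apply/nbhP; exists p => //; apply: mem1.
    case: (boolP (c \in Y)) => cY'; case: (boolP (e \in Y)) => eY.
    - exact: inj1.
    - by move/n12 => /(_ cX cY' eX eY).
    - by move/esym/n12 => /(_ eX eY cX cY').
    - by apply: inj2; rewrite inE ?cY' ?eY.
  case: (boolP (c \in Y)) => cY'; first exact: mem1.
  by have := mem2 c; rewrite !inE cX cY' => /(_ isT)/andP[].
(* No tight proper subset: match a arbitrarily and remove its partner. *)
have [b br] : exists b, b \in r a.
  apply/card_gt0P; have := hallX [set a]; rewrite sub1set aX cards1 => /(_ isT).
  by rewrite /nbh big_set1.
pose r2 c := r c :\ b.
have [||f [injf memf]] := IH r2 (X :\ a).
- by apply: leq_trans Xm; rewrite (cardsD1 a X) aX.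
- move=> Z ZX; have [->|Z0] := eqVneq Z set0; first by rewrite cards0.
  have ZsX : Z \subset X by apply: subset_trans ZX (subsetDl _ _).
  have ZnX : Z != X.
    by apply: contraTneq ZX => ->; rewrite subsetD1 aX andbF.
  have := slack Z; rewrite ZsX Z0 ZnX /= => ne.
  have lt : #|Z| < #|nbh r Z| by rewrite ltn_neqAle eq_sym ne hallX.
  have -> : nbh r2 Z = nbh r Z :\ b.
    apply/setP=> y; rewrite !inE; apply/nbhP/andP=> [[c cZ]|[yb /nbhP[c cZ yc]]].
      by rewrite !inE => /andP[-> yc]; split=> //; apply/nbhP; exists c.
    by exists c; rewrite // !inE yb.
  by move: lt; rewrite (cardsD1 b (nbh r Z)); case: (b \in _) => //=; lia.
exists (fun c => if c == a then b else f c); split=> [c e cX eX|c cX].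
  have nb q : q \in X -> q != a -> f q != b.
    by move=> qX qa; have := memf q; rewrite !inE qX qa => /(_ isT)/andP[].
  have [->|ca] := eqVneq c a; have [->|ea] := eqVneq e a => //.
  - by move=> eb; have := nb e eX ea; rewrite -eb eqxx.
  - by move=> eb; have := nb c cX ca; rewrite eb eqxx.
  - by apply: injf; rewrite !inE ?ca ?ea.
have [-> //|ca] := eqVneq c a.
by have := memf c; rewrite !inE cX ca => /(_ isT)/andP[].
Qed.
End Hall.

Local Open Scope ring_scope.

(** * Affine functions of a representation *)

Section AffineFunctions.
Variables (R : realType) (gT : finGroupType) (G : {group gT}).

Section OneRepresentation.
Variables (d : nat) (D : mx_representation R G d).
Implicit Types u v : gT -> R.

Definition affine_fun u :=
  exists (M : 'M[R]_d) (b : R), {in G, forall g, u g = \tr (M *m D g) + b}.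

Lemma eq_affine_fun u v : {in G, u =1 v} -> affine_fun u -> affine_fun v.
Proof. by move=> e [M [b h]]; exists M, b => g gG; rewrite -e ?h. Qed.

Lemma affine_fun_cst b : affine_fun (fun=> b).
Proof. by exists 0, b => g _; rewrite mul0mx mxtrace0 add0r. Qed.

Lemma affine_funD u v : affine_fun u -> affine_fun v -> affine_fun (fun g => u g + v g).
Proof.
move=> [M [b h]] [N [c k]]; exists (M + N), (b + c) => g gG.
by rewrite h // k // mulmxDl mxtraceD addrACA.
Qed.

Lemma affine_funZ (t : R) u : affine_fun u -> affine_fun (fun g => t * u g).
Proof.
move=> [M [b h]]; exists (t *: M), (t * b) => g gG.
by rewrite h // -scalemxAl mxtraceZ mulrDr.
Qed.

Lemma affine_fun_sum (I : finType) (P : pred I) (u : I -> gT -> R) :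
  (forall i, P i -> affine_fun (u i)) -> affine_fun (fun g => \sum_(i | P i) u i g).
Proof.
move=> h; have [MB MBP] : {MB : I -> 'M[R]_d * R & forall i, P i ->
    {in G, forall g, u i g = \tr ((MB i).1 *m D g) + (MB i).2}}.
  apply: (@choice _ _ (fun i MB => P i ->
    {in G, forall g, u i g = \tr (MB.1 *m D g) + MB.2})) => i.
  have [/h[M [b hM]]|nP] := boolP (P i); first by exists (M, b).
  by exists (0, 0).
exists (\sum_(i | P i) (MB i).1), (\sum_(i | P i) (MB i).2) => g gG.
rewrite mulmx_suml raddf_sum -big_split /=; apply: eq_bigr => i Pi.
exact: MBP.
Qed.

Lemma affine_fun_lmul x u : x \in G -> affine_fun u -> affine_fun (fun g => u (x * g)%g).
Proof.
move=> xG [M [b h]]; exists (M *m D x), b => g gG.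
by rewrite h ?groupM // repr_mxM // mulmxA.
Qed.

Lemma affine_fun_rmul x u : x \in G -> affine_fun u -> affine_fun (fun g => u (g * x)%g).
Proof.
move=> xG [M [b h]]; exists (D x *m M), b => g gG.
by rewrite h ?groupM // repr_mxM // mulmxA mxtrace_mulC mulmxA.
Qed.

(** * Cell systems and translations of the group *)

Section Cells.
Variables (n : nat).
Implicit Types F : gT -> 'S_n.

Definition cell_support F := forall i j, exists u,
  [/\ affine_fun u, {in G, forall g, 0 <= u g}
    & {in G, forall g, (u g != 0) = (F g i == j)}].

Definition cell_minimal F := forall u, affine_fun u -> {in G, forall g, 0 <= u g} ->
  (exists2 g, g \in G & u g != 0) ->
  exists i j, {in G, forall g, F g i = j -> u g != 0}.

Definition cell_system F := cell_support F /\ cell_minimal F.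

Lemma cell_system_transfer F (F' : gT -> 'S_n) :
  (forall i j, exists k l, {in G, forall g, (F' g i == j) = (F g k == l)}) ->
  (forall i j, exists k l, {in G, forall g, (F g i == j) = (F' g k == l)}) ->
  cell_system F -> cell_system F'.
Proof.
move=> h1 h2 [cs cm]; split=> [i j|u affu u0 un].
  have [k [l e]] := h1 i j; have [u [affu u0 us]] := cs k l.
  by exists u; split=> // g gG; rewrite us // e.
have [i [j hij]] := cm u affu u0 un; have [k [l e]] := h2 i j.
exists k, l => g gG /eqP; rewrite -e // => /eqP; exact: hij.
Qed.

Lemma cell_system_mulr F s : cell_system F -> cell_system (fun g => F g * s)%g.
Proof.
apply: cell_system_transfer => i j.
  by exists i, (s^-1%g j) => g _; rewrite permM (can2_eq (permK s) (permKV s)).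
by exists i, (s j) => g _; rewrite permM (inj_eq perm_inj).
Qed.

Lemma cell_system_inv F : cell_system F -> cell_system (fun g => (F g)^-1)%g.
Proof.
have e (s : 'S_n) i j : (s^-1%g i == j) = (s j == i).
  by rewrite (can2_eq (permKV s) (permK s)) eq_sym.
by apply: cell_system_transfer => i j; exists j, i => g _; rewrite e.
Qed.

(** A translate of the affine function supported on a cell is affine and nonnegative, so its support
    contains a cell; counting later turns this into equality. *)
Lemma cell_system_lmul F x : F @: G = [set: 'S_n] -> cell_system F -> x \in G ->
  forall i j, exists k l, {in G, forall g, F g k = l -> F (x * g)%g i = j}.
Proof.
move=> surF [cs cm] xG i j; have [u [affu u0 us]] := cs i j.
have [||k [l h]] := cm _ (affine_fun_lmul xG affu).
- by move=> g gG; rewrite u0 ?groupM.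
- have : tperm i j \in F @: G by rewrite surF inE.
  case/imsetP=> g gG e; exists (x^-1 * g)%g; rewrite ?groupM ?groupV //.
  by rewrite mulKVg us // -e tpermL.
by exists k, l => g gG /(h g gG); rewrite us ?groupM // => /eqP.
Qed.

Lemma cell_system_rmul F x : F @: G = [set: 'S_n] -> cell_system F -> x \in G ->
  forall i j, exists k l, {in G, forall g, F g k = l -> F (g * x)%g i = j}.
Proof.
move=> surF [cs cm] xG i j; have [u [affu u0 us]] := cs i j.
have [||k [l h]] := cm _ (affine_fun_rmul xG affu).
- by move=> g gG; rewrite u0 ?groupM.
- have : tperm i j \in F @: G by rewrite surF inE.
  case/imsetP=> g gG e; exists (g * x^-1)%g; rewrite ?groupM ?groupV //.
  by rewrite mulgKV us // -e tpermL.
by exists k, l => g gG /(h g gG); rewrite us ?groupM // => /eqP.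
Qed.

Section Bijection.
Variable F : gT -> 'S_n.
Hypotheses (injF : {in G &, injective F}) (surF : F @: G = [set: 'S_n]).

Lemma bij_inverse : exists Fi : 'S_n -> gT,
  [/\ forall s, Fi s \in G, cancel Fi F & {in G, cancel F Fi}].
Proof.
pose Fi s := odflt 1%g [pick g in G | F g == s].
have FiP s : Fi s \in G /\ F (Fi s) = s.
  rewrite /Fi; case: pickP => [g /andP[gG /eqP //]|].
  have : s \in F @: G by rewrite surF inE.
  by case/imsetP=> g gG e /(_ g); rewrite gG e eqxx.
exists Fi; split=> [s|s|g gG]; first by have [] := FiP s.
  by have [] := FiP s.
by have [? ?] := FiP (F g); apply: injF.
Qed.

Hypotheses (F1 : F 1%g = 1%g) (csF : cell_system F).

Lemma cell_system_lform x : (2 < n)%N -> x \in G -> exists a b,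
  {in G, forall g, F (x * g)%g = (a * F g * b)%g} \/
  {in G, forall g, F (x * g)%g = (a * (F g)^-1 * b)%g}.
Proof.
move=> n3 xG; have [Fi [FiG FFi FiF]] := bij_inverse.
have [|i j|a [b h]] := @cell_map_form n (fun s => F (x * Fi s)%g) n3.
- by move=> s t /injF e; apply/(can_inj FFi)/(mulgI x)/e; rewrite groupM.
- have [k [l h]] := cell_system_lmul surF csF xG i j.
  by exists k, l => s e; apply: h; rewrite ?FFi.
exists a, b; case: h => h; [left|right] => g gG; by rewrite -{1}(FiF g gG) h.
Qed.

Lemma cell_system_rform x : (2 < n)%N -> x \in G -> exists a b,
  {in G, forall g, F (g * x)%g = (a * F g * b)%g} \/
  {in G, forall g, F (g * x)%g = (a * (F g)^-1 * b)%g}.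
Proof.
move=> n3 xG; have [Fi [FiG FFi FiF]] := bij_inverse.
have [|i j|a [b h]] := @cell_map_form n (fun s => F (Fi s * x)%g) n3.
- by move=> s t /injF e; apply/(can_inj FFi)/(mulIg x)/e; rewrite groupM.
- have [k [l h]] := cell_system_rmul surF csF xG i j.
  by exists k, l => s e; apply: h; rewrite ?FFi.
exists a, b; case: h => h; [left|right] => g gG; by rewrite -{1}(FiF g gG) h.
Qed.

(** With F(xg) = a F(g)^(+-1) b, the case g = 1 gives F(x) = a b, and inversion preserves the
    sign. *)
Lemma cell_system_odd : (2 < n)%N ->
  {in G &, forall x y, odd_perm (F (x * y)%g) = odd_perm (F x) (+) odd_perm (F y)}.
Proof.
move=> n3 x y xG yG; have [a [b [h|h]]] := cell_system_lform n3 xG;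
  by have := h 1%g (group1 G); rewrite mulg1 F1 ?invg1 mulg1 h // => ->;
     rewrite !odd_permM ?odd_permV addbAC.
Qed.

(** Left and right translations become two commuting families on S_n; the two alternatives for the
    left one are the two conclusions. *)
Lemma cell_system_morph : (3 < n)%N ->
  {in G &, {morph F : x y / (x * y)%g}} \/ {in G &, forall x y, F (x * y)%g = (F y * F x)%g}.
Proof.
move=> n4; have n3 : (2 < n)%N by lia.
have [Fi [FiG FFi FiF]] := bij_inverse.
have Fi1 : Fi 1%g = 1%g by rewrite -F1 FiF.
pose A t s := F (Fi t * Fi s)%g; pose B t s := F (Fi s * Fi t)%g.
have regA : regular_family A.
  split=> [s||x y|x].
  - by exists s; rewrite /A Fi1 mulg1.
  - by exists 1%g => s; rewrite /A Fi1 mul1g.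
  - by exists (A x y) => s; rewrite /A !FiF ?groupM // mulgA.
  - have [a [b h]] := cell_system_lform n3 (FiG x); exists a, b.
    by case: h => h; [left|right] => s; rewrite /A h ?FFi.
have regB : regular_family B.
  split=> [s||x y|x].
  - by exists s; rewrite /B Fi1 mul1g.
  - by exists 1%g => s; rewrite /B Fi1 mulg1.
  - by exists (B x y) => s; rewrite /B !FiF ?groupM // mulgA.
  - have [a [b h]] := cell_system_rform n3 (FiG x); exists a, b.
    by case: h => h; [left|right] => s; rewrite /B h ?FFi.
have AB x y s : A x (B y s) = B y (A x s) by rewrite /A /B !FiF ?groupM // mulgA.
have A1 x : A x 1%g = x by rewrite /A Fi1 mulg1.
have [h|h] := commuting_regular_families n4 regA regB AB; [left|right] => x y xG yG.
  by have := h (F x) (F y); rewrite A1 /A !FiF.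
by have := h (F x) (F y); rewrite A1 /A !FiF.
Qed.
End Bijection.
End Cells.
End OneRepresentation.
End AffineFunctions.

(** In S_3 the sign determines the cells, and the sign of [F] agrees with that of any isomorphism
    [phi], so [phi] has the same cells. *)
Lemma cell_system_S3 (R : realType) (gT : finGroupType) (G : {group gT}) d
    (D : mx_representation R G d) (F : gT -> 'S_3) :
  {in G &, injective F} -> F @: G = [set: 'S_3] -> F 1%g = 1%g -> cell_system D F ->
  ~~ cyclic G ->
  exists phi : {morphism G >-> 'S_3}, isom G [set: 'S_3] phi /\ cell_system D phi.
Proof.
move=> injF surF F1 csF ncG.
have oG : #|G| = 6%N by rewrite -(card_in_imset injF) surF cardsT card_Sn.
have /isogP[phi injphi imphi] : G \isog [set: 'S_3].
  exact: isog_trans (order6_noncyclic oG ncG) (isog_symr S3_dihedral).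
exists phi; split; first by apply/isomP.
have oddF := cell_system_odd injF surF F1 csF (isT : 2 < 3)%N.
have surphi : phi @: G = [set: 'S_3] by rewrite -morphimEdom.
have injphi2 : {in G &, injective phi} by apply/injmP.
(* An element even under [phi] is a square, so multiplicativity makes it even under [F]. *)
have sub x : x \in G -> ~~ odd_perm (phi x) -> ~~ odd_perm (F x).
  move=> xG /S3_even_square[t e].
  have : t \in phi @: G by rewrite surphi inE.
  case/imsetP=> y yG ey; have -> : x = (y * y)%g by apply: injphi2; rewrite ?groupM // morphM // -ey.
  by rewrite oddF // addbb.
have eqo x : x \in G -> odd_perm (F x) = odd_perm (phi x).
  move=> xG; have [o|/(sub x xG)/negbTE //] := boolP (odd_perm (phi x)).
  apply: contraT => no.
  (* With F z odd, [x * z] would be even under [phi] but odd under [F]. *)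
  have : tperm ord0 ord_max \in F @: G by rewrite surF inE.
  case/imsetP=> z zG ez; have oz : odd_perm (F z) by rewrite -ez odd_tperm.
  have opz : odd_perm (phi z) by apply: contraT => /(sub z zG); rewrite oz.
  have := sub (x * z)%g; rewrite groupM // morphM // odd_permM o opz => /(_ isT isT).
  by rewrite oddF // oz (negbTE no).
have [Fi [FiG FFi FiF]] := bij_inverse injF surF.
have [Pi [PiG PPi PiP]] := bij_inverse injphi2 surphi.
apply: cell_system_transfer csF => i j.
  have [|s|k [l h]] := @S3_parity_cells (fun s => phi (Fi s)) _ _ i j.
  - by move=> s t /injphi2 e; apply/(can_inj FFi)/e.
  - by rewrite -eqo // FFi.
  - by exists k, l => g gG; rewrite -h FiF.
have [|s|k [l h]] := @S3_parity_cells (fun s => F (Pi s)) _ _ i j.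
- by move=> s t /injF e; apply/(can_inj PPi)/e.
- by rewrite eqo // PPi.
- by exists k, l => g gG; rewrite -h PiP.
Qed.

(** * Supports for the permutation representation *)

Section Birkhoff.
Variables (R : realType) (n : nat).
Implicit Types (X : 'I_n -> 'I_n -> nat) (m : 'I_n -> 'I_n -> R) (s t : 'S_n).

Definition line_sums X k := (forall i, \sum_j X i j = k)%N /\ (forall j, \sum_i X i j = k)%N.

(** Hall's condition holds since the rows in [Y] carry total k|Y|, all inside the columns of the
    neighbourhood, which carry k each. *)
Lemma line_sums_perm X k : (0 < k)%N -> line_sums X k ->
  exists s, forall i, (0 < X i (s i))%N.
Proof.
move=> k0 [rX cX].
have [n0|n0] := posnP n.
  by exists 1%g => i; have := ltn_ord i; rewrite [X in (_ < X)%N]n0.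
pose i0 := Ordinal n0.
pose r i := [set j | (0 < X i j)%N].
have [Y _|f [injf memf]] := @hall _ _ i0 r [set: 'I_n].
  rewrite -(leq_pmul2r k0) -!sum_nat_const.
  have -> : (\sum_(i in Y) k = \sum_(i in Y) \sum_(j in nbh r Y) X i j)%N.
    apply: eq_bigr => i iY; rewrite -(rX i) (bigID (mem (nbh r Y))) /=.
    rewrite [X in (_ + X)%N]big1 ?addn0 // => j; apply: contraNeq => Xij.
    by apply/nbhP; exists i; rewrite // inE lt0n.
  rewrite exchange_big /=; apply: leq_sum => j _; rewrite -(cX j).
  by rewrite [X in (_ <= X)%N](bigID (mem Y)) /= leq_addr.
have finj : injective f by move=> i j; apply: injf; rewrite inE.
exists (perm finj) => i; rewrite permE.
by have := memf i (in_setT _); rewrite inE.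
Qed.

Lemma line_sums_sub X k s : line_sums X k.+1 -> (forall i, 0 < X i (s i))%N ->
  line_sums (fun i j => X i j - (s i == j))%N k.
Proof.
move=> [rX cX] hs; have le i j : ((s i == j) <= X i j)%N.
  by case: eqP => [<-|//]; apply: hs.
split=> [i|j].
  rewrite sumnB // rX (bigD1 (s i)) //= eqxx big1 ?addn0 ?subn1 // => j.
  by rewrite eq_sym => /negbTE ->.
rewrite sumnB // cX (bigD1 (s^-1%g j)) //= permKV eqxx big1 ?addn0 ?subn1 // => i.
by apply: contraNeq; rewrite eqb0 negbK => /eqP <-; rewrite permK.
Qed.

(** Peeling off permutation matrices one by one writes [X] as a sum of k of them. *)
Lemma line_sums_pair_ge0 m : (forall s, 0 <= \sum_i m i (s i)) ->
  forall k X, line_sums X k -> 0 <= \sum_i \sum_j m i j * (X i j)%:R.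
Proof.
move=> m0; elim=> [|k IH] X lX.
  rewrite big1 // => i _; rewrite big1 // => j _.
  case: lX => rX _; have := rX i => /eqP; rewrite sum_nat_eq0 => /forallP/(_ j)/eqP ->.
  by rewrite mulr0.
have [s hs] := line_sums_perm (ltn0Sn k) lX.
have -> : \sum_i \sum_j m i j * (X i j)%:R =
    \sum_i m i (s i) + \sum_i \sum_j m i j * (X i j - (s i == j))%:R.
  rewrite -big_split /=; apply: eq_bigr => i _.
  rewrite (bigD1 (s i)) //= [in RHS](bigD1 (s i)) //= eqxx natrB ?hs //.
  rewrite mulrBr mulr1 addrA addrCA subrr addr0; congr (_ + _).
  by apply: eq_bigr => j; rewrite eq_sym => /negbTE ->; rewrite subn0.
by rewrite addr_ge0 // IH //; apply: line_sums_sub.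
Qed.

(** Adding one zero of m through each position gives a matrix X with positive entries, equal line
    sums and pairing 0. Removing [t] leaves a nonnegative pairing, so m is nonpositive at [t]. *)
Lemma zero_cover_eq0 m : (forall s, 0 <= \sum_i m i (s i)) ->
  (forall i j, exists2 s : 'S_n, s i = j & \sum_i m i (s i) = 0) ->
  forall t, \sum_i m i (t i) = 0.
Proof.
move=> m0 cov t; have [n0|n0] := posnP n.
  by rewrite big1 // => i _; have := ltn_ord i; rewrite [X in (_ < X)%N]n0.
pose i0 := Ordinal n0.
have [S SP] : {S : 'I_n * 'I_n -> 'S_n & forall p, S p p.1 = p.2 /\
    \sum_i m i (S p i) = 0}.
  apply: (@choice _ _ (fun p (s : 'S_n) => s p.1 = p.2 /\ \sum_i m i (s i) = 0)) => p.
  by have [s s1 s2] := cov p.1 p.2; exists s.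
pose X i j := (\sum_p (S p i == j))%N.
pose N := #|{: 'I_n * 'I_n}|.
have permrow s i : (\sum_j (s i == j) = 1)%N.
  rewrite (bigD1 (s i)) //= eqxx big1 ?addn0 // => j.
  by rewrite eq_sym => /negbTE ->.
have permcol (s : 'S_n) j : (\sum_i (s i == j) = 1)%N.
  rewrite (bigD1 (s^-1%g j)) //= permKV eqxx big1 ?addn0 // => i.
  by apply: contraNeq; rewrite eqb0 negbK => /eqP <-; rewrite permK.
have lX : line_sums X N.
  split=> [i|j]; rewrite exchange_big /=.
    by under eq_bigr => p _ do rewrite permrow; rewrite sum1_card.
  by under eq_bigr => p _ do rewrite permcol; rewrite sum1_card.
have X0 i j : (0 < X i j)%N.
  by rewrite /X (bigD1 (i, j)) //= (proj1 (SP (i, j))) eqxx.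
have [k Nk] : exists k, N = k.+1.
  by exists N.-1; rewrite prednK //; apply/card_gt0P; exists (i0, i0).
rewrite Nk in lX.
have pX : \sum_i \sum_j m i j * (X i j)%:R = 0.
  under eq_bigr => i _ do under eq_bigr => j _ do rewrite natr_sum mulr_sumr.
  under eq_bigr => i _ do rewrite exchange_big.
  rewrite exchange_big /= big1 // => p _.
  rewrite -[RHS](proj2 (SP p)); apply: eq_bigr => i _.
  rewrite (bigD1 (S p i)) //= eqxx mulr1 big1 ?addr0 // => j.
  by rewrite eq_sym => /negbTE ->; rewrite mulr0.
have := line_sums_pair_ge0 m0 (line_sums_sub lX (fun i => X0 i (t i))).
have -> : \sum_i \sum_j m i j * (X i j - (t i == j))%:R =
   \sum_i \sum_j m i j * (X i j)%:R - \sum_i m i (t i).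
  rewrite -sumrB; apply: eq_bigr => i _.
  rewrite (bigD1 (t i)) //= [in RHS](bigD1 (t i)) //= eqxx natrB ?X0 //.
  rewrite mulrBr mulr1 addrAC; congr (_ + _ - _).
  by apply: eq_bigr => j; rewrite eq_sym => /negbTE ->; rewrite subn0.
by rewrite pX sub0r oppr_ge0 => h; apply/eqP; rewrite eq_le h m0.
Qed.

Lemma mxtrace_mul_perm (M : 'M[R]_n) s : \tr (M *m perm_mx s) = \sum_i M (s i) i.
Proof.
rewrite mxtrace_mulC; apply: eq_bigr => i _; rewrite mxE (bigD1 (s i)) //= !mxE eqxx mul1r.
by rewrite big1 ?addr0 // => j; rewrite !mxE eq_sym => /negbTE ->; rewrite mul0r.
Qed.

Lemma perm_cell_minimal : (0 < n)%N -> cell_minimal (perm_repr R n) id.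
Proof.
move=> n0 u [M [b hu]] u0 [t _ ut].
(* Adding b/n to every entry of [M] absorbs the constant. *)
have ue s : u s = \sum_i (M (s i) i + b / n%:R).
  rewrite hu ?inE //= mxtrace_mul_perm big_split /= sumr_const card_ord -(mulr_natr (b / n%:R)) divfK //.
  by rewrite pnatr_eq0 -lt0n.
apply: contrapT => no.
suff /(_ t) e : forall t, \sum_i (M (t i) i + b / n%:R) = 0 by rewrite ue e eqxx in ut.
apply: (@zero_cover_eq0 (fun i j => M j i + b / n%:R)) => [s|i j].
- by rewrite -ue u0 ?inE.
- apply: contrapT => h; apply: no; exists i, j => s _ e; apply/eqP => us; apply: h.
  by exists s; rewrite -?ue.
Qed.

Lemma perm_cell_support i j (s : 'S_n) :
  \tr (delta_mx j i *m perm_mx s) = (s i == j)%:R :> R.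
Proof.
rewrite mxtrace_mul_perm (bigD1 i) //= mxE eqxx andbT big1 ?addr0 // => k ki.
by rewrite mxE (negbTE ki) andbF.
Qed.
End Birkhoff.

(** * Affine functions and constituents *)

Section Constituents.
Variables (R : realType) (gT : finGroupType) (G : {group gT}).

Lemma constituent_intertwiner m d (S : mx_representation R G m)
    (D : mx_representation R G d) : constituent S D ->
  exists2 W : 'M[R]_(m, d), row_free W & {in G, forall x, S x *m W = W *m D x}.
Proof.
move=> [_ [U [modU [B _ Bfree hB]]]]; exists (val_submod B).
  rewrite /row_free val_submodE mxrankMfree; first exact: Bfree.
  by rewrite /row_free val_submod1.
by move=> x xG; rewrite -(val_submodJ modU) // -hB // val_submodE mulmxA -val_submodE.
Qed.

(** By irreducibility the kernel of [W] is zero, so the row space of [W] is a copy of [S] inside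
    [D]. *)
Lemma intertwiner_constituent m d (S : mx_representation R G m)
    (D : mx_representation R G d) (W : 'M[R]_(m, d)) :
  mx_irreducible S -> W != 0 -> {in G, forall x, S x *m W = W *m D x} ->
  constituent S D.
Proof.
move=> irrS W0 hW; split=> //; have [m0 simS] := (mx_irrP S).1 irrS.
have Wfree : row_free W.
  rewrite -kermx_eq0; apply: contraR W0 => k0.
  have modK : mxmodule S (kermx W).
    apply/mxmoduleP=> x xG; apply/sub_kermxP.
    by rewrite -mulmxA hW // mulmxA mulmx_ker mul0mx.
  have /row_fullP[B BK] := simS _ modK k0.
  by rewrite -[W]mul1mx -BK -mulmxA mulmx_ker mulmx0.
have modU : mxmodule D <<W>>%MS.
  apply/mxmoduleP=> x xG; rewrite (eqmxMr _ (genmxE W)) genmxE -hW //.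
  exact: submxMl.
exists <<W>>%MS, modU; have WU : (W <= <<W>>)%MS by rewrite genmxE.
exists (in_submod <<W>>%MS W).
- by rewrite genmxE (eqP Wfree).
- by rewrite /row_free mxrank_in_submod.
move=> x xG; rewrite /= -in_submodJ // -hW //.
by rewrite in_submodE mulmxA -in_submodE.
Qed.

(** An embedding [W] has a right inverse, so S(g) is [W] times D(g) times that inverse. *)
Lemma constituent_affine m d (S : mx_representation R G m)
    (D : mx_representation R G d) (N : 'M[R]_m) : constituent S D ->
  affine_fun D (fun g => \tr (N *m S g)).
Proof.
move=> /constituent_intertwiner[W Wfree hW].
exists (pinvmx W *m N *m W), 0 => g gG; rewrite addr0.
have -> : S g = W *m D g *m pinvmx W by rewrite -hW // mulmxKp.
by rewrite mulmxA mxtrace_mulC !mulmxA.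
Qed.

(** The sum Z satisfies Z S(x) = Z; were it nonzero, irreducibility would make it invertible and S
    trivial. *)
Lemma sum_nontrivial_eq0 m (S : mx_representation R G m) :
  mx_irreducible S -> nontrivial_repr S -> \sum_(g in G) S g^-1%g = 0.
Proof.
move=> irrS ntS; set Z := \sum_(g in G) _; have [m0 simS] := (mx_irrP S).1 irrS.
have ZS x : x \in G -> Z *m S x = Z.
  move=> xG; rewrite mulmx_suml [RHS](reindex_inj (mulgI x^-1%g)) /=.
  apply: eq_big => [g|g gG]; first by rewrite groupMl ?groupV.
  by rewrite invMg invgK repr_mxM ?groupV.
move: ntS; apply: contraNeq => Z0; apply/subsetP=> x xG.
have modZ : mxmodule S Z by apply/mxmoduleP=> y yG; rewrite ZS.
have /row_fullP[B BZ] := simS _ modZ Z0.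
by apply/rkerP; split=> //; rewrite -[S x]mul1mx -BZ -mulmxA ZS.
Qed.

(* If S is not a constituent of D, averaging gives no nonzero intertwiner, so
   the coefficients of S are orthogonal to those of D, to constants, and hence
   to themselves. *)
Lemma affine_constituent m d (S : mx_representation R G m)
    (D : mx_representation R G d) : mx_irreducible S -> nontrivial_repr S ->
  (forall N, affine_fun D (fun g => \tr (N *m S g))) -> constituent S D.
Proof.
move=> irrS ntS affS; apply: contrapT => ncon.
have [m0 _] := (mx_irrP S).1 irrS.
have avg0 (X : 'M[R]_(m, d)) : \sum_(g in G) S g^-1%g *m X *m D g = 0.
  set W := \sum_(g in G) _; apply/eqP; apply: contra_notT ncon => W0.
  apply: (intertwiner_constituent irrS W0) => x xG.
  rewrite mulmx_sumr mulmx_suml [LHS](reindex_inj (mulIg x)) /=.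
  apply: eq_big => [g|g gG]; first by rewrite groupMr.
  rewrite groupMr // in gG; rewrite invMg !mulmxA -repr_mxM ?groupM ?groupV //.
  by rewrite mulKVg repr_mxM // !mulmxA.
have orthD i j k l : \sum_(g in G) S g^-1%g i j * D g k l = 0.
  have := congr1 (fun A : 'M_(m, d) => A i l) (avg0 (delta_mx j k)).
  rewrite summxE [RHS]mxE => e; rewrite -[RHS]e; apply: eq_bigr => g gG.
  rewrite mxE (bigD1 k) //= mxE (bigD1 j) //= mxE !eqxx mulr1 big1 => [|j' nj].
    rewrite addr0 big1 ?addr0 // => k' nk; rewrite mxE big1 ?mul0r // => j' _.
    by rewrite mxE (negbTE nk) andbF mulr0.
  by rewrite mxE (negbTE nj) mulr0.
have orth1 i j : \sum_(g in G) S g^-1%g i j = 0.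
  by rewrite -summxE sum_nontrivial_eq0 // mxE.
have orth i j u : affine_fun D u -> \sum_(g in G) S g^-1%g i j * u g = 0.
  move=> [M [b hu]].
  have -> : \sum_(g in G) S g^-1%g i j * u g =
      \sum_p \sum_q M p q * (\sum_(g in G) S g^-1%g i j * D g q p) +
      b * \sum_(g in G) S g^-1%g i j.
    rewrite mulr_sumr; under [in RHS]eq_bigr => p _ do under eq_bigr => q _ do rewrite mulr_sumr.
    under [in RHS]eq_bigr => p _ do rewrite exchange_big.
    rewrite exchange_big -big_split /=; apply: eq_bigr => g gG.
    rewrite hu // mulrDr [b * _]mulrC; congr (_ + _).
    rewrite mulr_sumr; apply: eq_bigr => p _; rewrite mxE mulr_sumr; apply: eq_bigr => q _.
    by rewrite mulrCA.
  rewrite orth1 mulr0 addr0 big1 // => p _; rewrite big1 // => q _.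
  by rewrite orthD mulr0.
pose i : 'I_m := Ordinal m0.
(* Summing over [q] gives the entry (i, i) of S(g^-1) S(g) = 1, so the total is also |G|. *)
have : \sum_q \sum_(g in G) S g^-1%g i q * S g q i = 0.
  rewrite big1 // => q _.
  have := orth i q _ (affS (delta_mx i q)).
  move=> e; rewrite -[RHS]e; apply: eq_bigr => g _; congr (_ * _).
  rewrite mxtrace_mulC /mxtrace (bigD1 q) //= mxE (bigD1 i) //= mxE !eqxx mulr1.
  rewrite big1 ?addr0 => [|k nk]; last by rewrite mxE (negbTE nk) mulr0.
  rewrite big1 ?addr0 // => k nk; rewrite mxE big1 // => l _.
  by rewrite mxE (negbTE nk) andbF mulr0.
rewrite exchange_big /=.
have -> : \sum_(g in G) \sum_q S g^-1%g i q * S g q i = #|G|%:R.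
  rewrite -sum1_card natr_sum; apply: eq_bigr => g gG.
  have := congr1 (fun A : 'M_m => A i i) (repr_mxKV S gG 1%:M).
  by rewrite mul1mx !mxE eqxx repr_mxV //.
by move/eqP; rewrite pnatr_eq0 eqn0Ngt cardG_gt0.
Qed.

Lemma stably_equiv_affine d1 d2 (D1 : mx_representation R G d1)
    (D2 : mx_representation R G d2) :
  (forall u, affine_fun D1 u <-> affine_fun D2 u) -> stably_equiv D1 D2.
Proof.
move=> h m S ntS; split=> con; have [irrS _] := con;
  by apply: affine_constituent => // N; apply/h/constituent_affine.
Qed.
End Constituents.

(** * Affine functions when the cells come from an isomorphism *)

Section PermAffine.
Variables (R : realType) (gT : finGroupType) (G : {group gT}) (n d : nat).
Variables (D : mx_representation R G d) (phi : {morphism G >-> 'S_n}).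
Hypotheses (isophi : isom G [set: 'S_n]%g phi) (csphi : cell_system D phi).
Variable sG : G \subset (phi @*^-1 [set: 'S_n])%g.
Let P := subg_repr (morphpre_repr phi (perm_repr R n)) sG.

Lemma cell_affine_perm i j : affine_fun P (fun g => (phi g i == j)%:R).
Proof. by exists (delta_mx j i), 0 => g gG; rewrite addr0 -perm_cell_support. Qed.

(** Summing left translates of [u] over the stabiliser H of [i] gives a function that is constant
    and positive on H and zero elsewhere. A right translation moves this to any cell in row [i]. *)
Lemma cell_affine i j : affine_fun D (fun g => (phi g i == j)%:R).
Proof.
have [u [affu u0 us]] := csphi.1 i i.
pose H := [set h in G | phi h i == i].
pose K := \sum_(h in H) u h.
have H1 : 1%g \in H by rewrite inE group1 morph1 perm1 eqxx.
have K0 : 0 < K.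
  rewrite /K (bigD1 1%g) //= ltr_pwDl //.
    by rewrite lt_neqAle eq_sym us // morph1 perm1 eqxx u0.
  by apply: sumr_ge0 => h /andP[+ _]; rewrite inE => /andP[hG _]; apply: u0.
have affv : affine_fun D (fun g => \sum_(h in H) u (h * g)%g).
  by apply: affine_fun_sum => h; rewrite inE => /andP[hG _]; apply: affine_fun_lmul.
have aff1 : affine_fun D (fun g => (phi g i == i)%:R).
  apply: eq_affine_fun (affine_funZ K^-1 affv) => g gG /=.
  have [gi|gi] := eqVneq (phi g i) i.
    rewrite -[RHS](mulVf (lt0r_neq0 K0)); congr (_ * _).
    rewrite [RHS](reindex_inj (mulIg g)) /=; apply: eq_bigl => h; rewrite !inE.
    rewrite groupMr //; case: (boolP (h \in G)) => //= hG; rewrite morphM // permM.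
    by rewrite -[X in _ = (_ == X)]gi (inj_eq perm_inj).
  rewrite big1 ?mulr0 // => h; rewrite inE => /andP[hG /eqP hi].
  apply/eqP; rewrite -[_ == _]negbK us ?groupM // morphM // permM hi.
  by rewrite gi.
have [k kG ek] : exists2 k, k \in G & phi k = tperm i j.
  have [_ e] := isomP isophi.
  have : tperm i j \in (phi @* G)%g by rewrite e inE.
  by case/morphimP=> k _ kG ->; exists k.
apply: eq_affine_fun (affine_fun_rmul kG aff1) => g gG /=.
by rewrite morphM // permM ek -[X in (_ == X)%:R = _](tpermR i j) (inj_eq perm_inj).
Qed.

Lemma affine_perm_sub u : affine_fun P u -> affine_fun D u.
Proof.
move=> [M [b hu]].
apply: (@eq_affine_fun _ _ _ _ _ (fun g => \sum_i \sum_j M j i * (phi g i == j)%:R + b)).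
  move=> g gG; rewrite hu //= mxtrace_mul_perm; congr (_ + _); apply: eq_bigr => i _.
  rewrite (bigD1 (phi g i)) //= eqxx mulr1 big1 ?addr0 // => j.
  by rewrite eq_sym => /negbTE ->; rewrite mulr0.
apply: affine_funD (affine_fun_cst _ _); apply: affine_fun_sum => i _.
by apply: affine_fun_sum => j _; apply: affine_funZ; apply: cell_affine.
Qed.

Lemma affine_sub_perm u : affine_fun D u -> affine_fun P u.
Proof.
(* Peel off cell indicators; each step enlarges the zero set. *)
have ge0_case v : affine_fun D v -> {in G, forall g, 0 <= v g} -> affine_fun P v.
  move: {2}#|[set g in G | v g != 0]|.+1 (ltnSn #|[set g in G | v g != 0]|) => m.
  elim: m => // m IH in v *; rewrite ltnS => vm affv v0.
  have [nz|z] := pselect (exists2 g, g \in G & v g != 0); last first.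
    apply: eq_affine_fun (affine_fun_cst _ 0) => g gG /=.
    by apply/eqP; rewrite eq_sym; apply: contraT => vg; case: z; exists g.
  have [i [j hij]] := csphi.2 v affv v0 nz.
  have [k kG ek] : exists2 k, k \in G & phi k = tperm i j.
    have [_ e] := isomP isophi.
    have : tperm i j \in (phi @* G)%g by rewrite e inE.
    by case/morphimP=> k _ kG ->; exists k.
  have kij : (k \in G) && (phi k i == j) by rewrite kG ek tpermL eqxx.
  (* Subtracting the minimum over the cell keeps [v] nonnegative and creates a zero at [g0]. *)
  pose g0 := [arg min_(g < k | (g \in G) && (phi g i == j)) v g]%O.
  have [] : [/\ g0 \in G, phi g0 i = j & forall g, g \in G -> phi g i = j -> v g0 <= v g].
    rewrite /g0; case: arg_minP => // g /andP[gG /eqP gij] hmin; split=> // h hG /eqP hij'.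
    by apply: hmin; rewrite hG hij'.
  move=> g0G g0ij g0min.
  pose w g := v g + - v g0 * (phi g i == j)%:R.
  have affw : affine_fun D w by apply: affine_funD => //; apply: affine_funZ; apply: cell_affine.
  have w0 : {in G, forall g, 0 <= w g}.
    move=> g gG; rewrite /w; have [e|e] := eqVneq (phi g i) j.
      by rewrite mulr1 subr_ge0 g0min.
    by rewrite mulr0 addr0 v0.
  have Pw : affine_fun P w.
    apply: IH => //; apply: leq_trans vm; apply: proper_card; apply/properP; split.
      apply/subsetP=> g; rewrite !inE => /andP[gG wg]; rewrite gG /=.
      have [e|e] := eqVneq (phi g i) j; first exact: hij.
      by move: wg; rewrite /w (negbTE e) mulr0 addr0.
    exists g0; rewrite !inE g0G /= ?hij //.
    by rewrite /w g0ij eqxx mulr1 subrr eqxx.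
  apply: (@eq_affine_fun _ _ _ _ _ (fun g => w g + v g0 * (phi g i == j)%:R)).
    by move=> g gG; rewrite /w mulNr addrNK.
  by apply: affine_funD => //; apply: affine_funZ; apply: cell_affine_perm.
move=> affu; pose b := \sum_(g in G) `|u g|.
apply: (@eq_affine_fun _ _ _ _ _ (fun g => (u g + b) + - b)).
  by move=> g _; rewrite addrK.
apply: affine_funD (affine_fun_cst _ _); apply: ge0_case.
  by apply: affine_funD => //; apply: affine_fun_cst.
move=> g gG; rewrite /b (bigD1 g) //= addrA addr_ge0 ?sumr_ge0 //.
by rewrite addrC -lerBlDr sub0r -normrN ler_norm.
Qed.

Lemma perm_stably_equiv : stably_equiv D P.
Proof. by apply: stably_equiv_affine => u; split; [exact: affine_sub_perm | exact: affine_perm_sub]. Qed.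
End PermAffine.

(** * Faces of representation polytopes *)

Section RepPolytope.
Variables (R : realType) (gT : finGroupType) (G : {group gT}) (d : nat).
Variable D : mx_representation R G d.
Implicit Types (X Y : 'M[R]_d) (g h : gT).

Definition trace_form (N : 'M[R]_d) : {scalar 'M[R]_d} := (@mxtrace R d \o mulmx N).

Lemma trace_formE N X : trace_form N X = \tr (N *m X).
Proof. by []. Qed.

Lemma scalar_trace_form (c : {scalar 'M[R]_d}) : exists N, forall X, c X = \tr (N *m X).
Proof.
exists (\matrix_(j, i) c (delta_mx i j)) => X.
rewrite {1}(matrix_sum_delta X) linear_sum /=.
under eq_bigr => i _ do rewrite linear_sum /=.
rewrite exchange_big /=; apply: eq_bigr => j _.
by rewrite mxE; apply: eq_bigr => i _; rewrite linearZ mxE /= mulrC.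
Qed.

Lemma rep_polytope_gen g : g \in G -> rep_polytope D (D g).
Proof.
move=> gG; exists 1%N, (fun=> 1), (fun=> D g); split=> //.
- by rewrite big_ord1.
- by move=> _; exists g.
- by rewrite big_ord1 scale1r.
Qed.

Lemma rep_polytope_le (c : {scalar 'M[R]_d}) b :
  {in G, forall g, c (D g) <= b} -> forall x, rep_polytope D x -> c x <= b.
Proof.
move=> hc x [k [w [p [w0 w1 pG ->]]]]; rewrite linear_sum /=.
rewrite -[b]mul1r -w1 mulr_suml; apply: ler_sum => i _.
by rewrite linearZ /= ler_wpM2l //; have [g gG <-] := pG i; apply: hc.
Qed.

(** The weighted slacks b - c(p i) are nonnegative and sum to zero, so each vanishes. *)
Lemma rep_polytope_max (c : {scalar 'M[R]_d}) b x :
  {in G, forall g, c (D g) <= b} -> rep_polytope D x -> c x = b ->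
  exists (k : nat) (w : 'I_k -> R) (a : 'I_k -> gT),
    [/\ \sum_i w i = 1, x = \sum_i w i *: D (a i)
      & forall i, w i != 0 -> a i \in G /\ c (D (a i)) = b].
Proof.
move=> hc [k [w [p [w0 w1 pG ex]]]] cx.
have [a aP] : {a : 'I_k -> gT & forall i, a i \in G /\ D (a i) = p i}.
  apply: (@choice _ _ (fun i g => g \in G /\ D g = p i)) => i.
  by have [g gG e] := pG i; exists g.
exists k, w, a; split=> [//||i wi].
  by rewrite ex; apply: eq_bigr => i _; have [_ ->] := aP i.
have [aG ea] := aP i; split=> //.
have : \sum_i w i * (b - c (p i)) = 0.
  under eq_bigr => j _ do rewrite mulrBr.
  rewrite sumrB -mulr_suml w1 mul1r -{1}cx ex linear_sum /=.
  by apply/eqP; rewrite subr_eq0; apply/eqP; apply: eq_bigr => j _; rewrite linearZ.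
move/eqP; rewrite psumr_eq0 => [/allP/(_ i)|j _].
  by rewrite mem_index_enum => /(_ isT); rewrite mulf_eq0 (negbTE wi) subr_eq0 -ea => /eqP.
by rewrite mulr_ge0 // subr_ge0; have [ajG <-] := aP j; apply: hc.
Qed.

(** The trace inner product averaged over [G], so that left multiplication by [D x], for x in [G],
    is an isometry. *)
Definition inv_form X Y := \sum_(h in G) \tr ((D h *m Y)^T *m (D h *m X)).

Lemma inv_form_sym X Y : inv_form X Y = inv_form Y X.
Proof.
by apply: eq_bigr => h _; rewrite -mxtrace_tr trmx_mul trmxK.
Qed.

Lemma inv_form_subl X Y Z : inv_form (X - Y) Z = inv_form X Z - inv_form Y Z.
Proof.
by rewrite -sumrB; apply: eq_bigr => h _; rewrite mulmxBr mulmxBr raddfB.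
Qed.

Lemma mxtrace_tr_mul_ge0 (A : 'M[R]_d) : 0 <= \tr (A^T *m A).
Proof.
apply: sumr_ge0 => i _; rewrite mxE; apply: sumr_ge0 => j _.
by rewrite mxE -expr2 sqr_ge0.
Qed.

Lemma inv_form_ge0 X : 0 <= inv_form X X.
Proof. by apply: sumr_ge0 => h _; apply: mxtrace_tr_mul_ge0. Qed.

Lemma inv_form_eq0 X : inv_form X X = 0 -> X = 0.
Proof.
move/eqP; rewrite psumr_eq0 => [/allP/(_ 1%g)|h _]; last exact: mxtrace_tr_mul_ge0.
rewrite mem_index_enum group1 /= repr_mx1 mul1mx => /(_ isT).
rewrite psumr_eq0 => [/allP h|i _]; last first.
  by rewrite mxE; apply: sumr_ge0 => j _; rewrite mxE -expr2 sqr_ge0.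
apply/matrixP=> j i; have := h i; rewrite mem_index_enum mxE => /(_ isT) /=.
rewrite psumr_eq0 => [/allP/(_ j)|k _]; last by rewrite mxE -expr2 sqr_ge0.
by rewrite mem_index_enum mxE -expr2 sqrf_eq0 mxE => /(_ isT) /eqP.
Qed.

Lemma inv_form_gen g : g \in G -> inv_form (D g) (D g) = inv_form 1%:M 1%:M.
Proof.
move=> gG; rewrite /inv_form [RHS](reindex_inj (mulIg g)) /=.
by apply: eq_big => [h|h hG]; rewrite ?groupMr // mulmx1 repr_mxM.
Qed.

Lemma inv_form_trace Y : exists N, forall X, inv_form X Y = \tr (N *m X).
Proof.
exists (\sum_(h in G) (D h *m Y)^T *m D h) => X.
by rewrite mulmx_suml raddf_sum; apply: eq_bigr => h _; rewrite mulmxA.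
Qed.

(* All D g lie on a common sphere of an invariant inner product. *)
Lemma rep_polytope_vertex g : g \in G -> vertices (rep_polytope D) (D g).
Proof.
move=> gG; have [N NE] := inv_form_trace (D g).
pose b := inv_form 1%:M 1%:M.
(* Polarization for vectors of equal squared norm [b]. *)
have key h : h \in G -> \tr (N *m D h) = b - inv_form (D h - D g) (D h - D g) / 2%:R.
  move=> hG; rewrite -NE inv_form_subl ![inv_form _ (_ - _)]inv_form_sym !inv_form_subl.
  rewrite !inv_form_gen // (inv_form_sym (D g)) -/b.
  by field.
have le h : h \in G -> trace_form N (D h) <= b.
  by move=> hG; rewrite trace_formE key // lerBlDr lerDl divr_ge0 ?inv_form_ge0.
have eqb h : h \in G -> trace_form N (D h) = b -> D h = D g.
  move=> hG; rewrite trace_formE key // => /eqP; rewrite subr_eq addrC -subr_eq subrr.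
  rewrite eq_sym mulf_eq0 invr_eq0 pnatr_eq0 orbF => /eqP/inv_form_eq0/eqP.
  by rewrite subr_eq0 => /eqP.
exists (trace_form N), b; split; first exact: rep_polytope_le.
apply/seteqP; split=> x /=.
  move=> ->; split; first exact: rep_polytope_gen.
  by rewrite key // subrr /inv_form big1 ?mul0r ?subr0 // => h _; rewrite mulmx0 mulmx0 mxtrace0.
move=> [Px cx]; have [k [w [a [w1 -> wa]]]] := rep_polytope_max le Px cx.
rewrite -[RHS]scale1r -w1 scaler_suml; apply: eq_bigr => i _.
have [->|wi] := eqVneq (w i) 0; first by rewrite !scale0r.
by have [aG ca] := wa i wi; rewrite (eqb (a i)).
Qed.

(** A functional exposing [v] is also maximal at some [D g] of nonzero weight in [v], which
    therefore equals [v]. *)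
Lemma vertices_rep_polytope :
  vertices (rep_polytope D) = (D @` [set` G])%classic.
Proof.
apply/seteqP; split=> [v [c [b [cb e]]]|_ [g gG <-]]; last exact: rep_polytope_vertex.
have [Pv cv] : rep_polytope D v /\ c v = b.
  by have : [set v]%classic v by []; rewrite e.
have le g : g \in G -> c (D g) <= b by move=> gG; apply/cb/rep_polytope_gen.
have [k [w [a [w1 ev wa]]]] := rep_polytope_max le Pv cv.
have [i wi] : exists i, w i != 0.
  apply: contrapT => h; move/eqP: w1; rewrite big1 1?eq_sym ?oner_eq0 // => i _.
  by apply/eqP; apply: contrapT => wi; apply: h; exists i; apply/negP.
have [aG ca] := wa i wi; exists (a i) => //.
have : [set x | rep_polytope D x /\ c x = b]%classic (D (a i)).
  by split=> //; apply: rep_polytope_gen.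
by rewrite -e.
Qed.

(** The correspondence takes a functional [c] with bound [b] to the slack g -> b - c(D g). *)
Lemma face_vertices_rep_polytope S :
  face_vertices (rep_polytope D) S <->
  exists u, [/\ affine_fun D u, {in G, forall g, 0 <= u g}
    & S = (D @` [set g | g \in G /\ u g = 0])%classic].
Proof.
split=> [[F [c [b [cb ->]] ->]]|[u [[M [b hu]] u0 ->]]].
  have [N cN] := scalar_trace_form c.
  exists (fun g => b - c (D g)); split.
  - by exists (- N), b => g _; rewrite mulNmx raddfN /= -cN addrC.
  - by move=> g gG; rewrite subr_ge0; apply/cb/rep_polytope_gen.
  rewrite vertices_rep_polytope; apply/seteqP; split=> x /=.
    by move=> [[_ cx] [g gG e]]; exists g => //; split=> //; rewrite e cx subrr.
  move=> [g [gG /eqP]]; rewrite subr_eq0 => /eqP e <-; split; last by exists g.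
  by split; [apply: rep_polytope_gen | rewrite e].
have le g : g \in G -> trace_form (- M) (D g) <= b.
  by move=> gG; rewrite trace_formE mulNmx raddfN /= lerNl -subr_ge0 opprK -hu // u0.
have eqb g : g \in G -> (trace_form (- M) (D g) = b) <-> u g = 0.
  move=> gG; rewrite trace_formE mulNmx raddfN /= hu //.
  by split=> [<-|/eqP]; rewrite ?subrr // addr_eq0 => /eqP ->; rewrite opprK.
exists [set x | rep_polytope D x /\ trace_form (- M) x = b]%classic.
  by exists (trace_form (- M)), b; split=> //; apply: rep_polytope_le.
rewrite vertices_rep_polytope; apply/seteqP; split=> x /=.
  move=> [g [gG ug] <-]; split; last by exists g.
  by split; [apply: rep_polytope_gen | apply/eqb].
by move=> [[_ cx] [g gG e]]; exists g => //; split=> //; apply/eqb; rewrite ?e.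
Qed.
End RepPolytope.

(** * From combinatorial equivalence to effective equivalence *)

Lemma perm_mx_inj (R : realType) n : injective (@perm_mx R n).
Proof.
move=> s t e; apply/permP=> i; apply/eqP/contraT => ne.
have /eqP := congr1 (fun A : 'M[R]_n => A i (s i)) e.
by rewrite !mxE eqxx [t i == _]eq_sym (negbTE ne) oner_eq0.
Qed.

(** [F] reads the vertex bijection as a map into S_n. Faces pulled back from the Birkhoff polytope
    give the supports; faces pushed forward give minimality. *)
Lemma comb_equiv_cell_system (R : realType) (gT : finGroupType) (G : {group gT})
    d (D : mx_representation R G d) n :
  (0 < n)%N -> mx_faithful D -> comb_equiv (rep_polytope D) (@Birkhoff R n) ->
  exists F : gT -> 'S_n,
    [/\ {in G &, injective F}, F @: G = [set: 'S_n] & cell_system D F].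
Proof.
move=> n0 faithD [f [bijf facef]]; have injD := mx_faithful_inj faithD.
rewrite /Birkhoff !vertices_rep_polytope in bijf facef.
case: bijf => funf injf surf.
pose F g := odflt 1%g [pick s : 'S_n | perm_mx s == f (D g)].
have FE g : g \in G -> perm_mx (F g) = f (D g).
  move=> gG; have [s _ es] : (perm_repr R n @` [set` [set: 'S_n]%G])%classic (f (D g)).
    by apply: funf; exists g.
  by rewrite /F; case: pickP => [t /eqP //|/(_ s)]; rewrite -es eqxx.
have memD g : g \in G -> D g \in (D @` [set` G])%classic.
  by move=> gG; apply/mem_set; exists g.
have injF : {in G &, injective F}.
  move=> g h gG hG e; apply: injD => //.
  by apply: (injf _ _ (memD _ gG) (memD _ hG)); rewrite -!FE // e.
have surF s : exists2 g, g \in G & F g = s.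
  have [_ [g gG <-] e] := surf (perm_mx s) (ex_intro2 _ _ s (in_setT s) erefl).
  by exists g => //; apply: (@perm_mx_inj R); rewrite FE.
exists F; split=> //.
  by apply/setP=> s; rewrite inE; apply/imsetP; have [g gG <-] := surF s; exists g.
split=> [i j|u affu u0 [g1 g1G ug1]].
  (* [f] maps [S] onto the zero set of the indicator of the cell. *)
  pose S := (D @` [set g | g \in G /\ F g i != j])%classic.
  have /facef[_ h] : (S `<=` D @` [set` G])%classic by move=> _ [g [gG _] <-]; exists g.
  have /h/face_vertices_rep_polytope[u [affu u0 eS]] :
      face_vertices (rep_polytope (perm_repr R n)) (f @` S)%classic.
    apply/face_vertices_rep_polytope; exists (fun s : 'S_n => (s i == j)%:R); split.
    - by exists (delta_mx j i), 0 => s _; rewrite addr0 -perm_cell_support.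
    - by move=> s _; rewrite ler0n.
    apply/seteqP; split=> x /=.
      move=> [_ [g [gG /negbTE gij] <-] <-]; exists (F g); rewrite ?FE //.
      by rewrite gij inE.
    move=> [s [_ /eqP]]; rewrite pnatr_eq0 eqb0 => sij <-.
    have [g gG e] := surF s; exists (D g); last by rewrite -FE // e.
    by exists g => //; split=> //; rewrite e.
  exists u; split=> // g gG; apply/idP/idP => h1.
    apply: contraT => h2; have : S (D g) by exists g.
    by rewrite eS => -[g' [g'G ug'] /injD e]; rewrite -e // ug' eqxx in h1.
  apply/eqP => ug; have : S (D g) by rewrite eS; exists g.
  by case=> g' [g'G +] /injD e; rewrite e // h1.
pose S := (D @` [set g | g \in G /\ u g = 0])%classic.
have /facef[h _] : (S `<=` D @` [set` G])%classic by move=> _ [g [gG _] <-]; exists g.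
have /h/face_vertices_rep_polytope[v [affv v0 eS]] : face_vertices (rep_polytope D) S.
  by apply/face_vertices_rep_polytope; exists u.
have uv g : g \in G -> (u g = 0) <-> (v (F g) = 0).
  move=> gG; split=> e.
    have : (f @` S)%classic (f (D g)) by exists (D g) => //; exists g.
    by rewrite eS => -[s [_ vs]]; rewrite /= -FE // => /perm_mx_inj <-.
  have : (f @` S)%classic (f (D g)).
    by rewrite eS; exists (F g); rewrite /= ?FE // inE.
  case=> _ [g' [g'G ug'] <-] /injf e2.
  by have /injD <- := e2 (memD _ g'G) (memD _ gG).
have [|i [j hij]] := perm_cell_minimal n0 affv v0.
  by exists (F g1); rewrite ?inE //; apply/eqP => /uv e; rewrite e ?eqxx in ug1.
exists i, j => g gG e; apply/eqP => /uv - /(_ gG) e2.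
by have := hij (F g) (in_setT _) e; rewrite e2 eqxx.
Qed.

Lemma cell_system_isom (R : realType) (gT : finGroupType) (G : {group gT})
    d (D : mx_representation R G d) n (F : gT -> 'S_n) :
  {in G &, injective F} -> F @: G = [set: 'S_n] -> cell_system D F ->
  {in G &, {morph F : x y / (x * y)%g}} ->
  exists phi : {morphism G >-> 'S_n}, isom G [set: 'S_n]%g phi /\ cell_system D phi.
Proof.
move=> injF surF csF morF; exists (Morphism morF); split=> //.
by apply/isomP; split; [apply/injmP | rewrite morphimEdom].
Qed.

(** In a group of order at most 2, two nontrivial elements have product 1. *)
Lemma card_le2_morph (gT : finGroupType) (G : {group gT}) n (F : gT -> 'S_n) :
  (n <= 2)%N -> {in G &, injective F} -> F @: G = [set: 'S_n] -> F 1%g = 1%g ->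
  {in G &, {morph F : x y / (x * y)%g}}.
Proof.
move=> n2 injF surF F1.
have oG : (#|G| <= 2)%N.
  rewrite -(card_in_imset injF) surF cardsT card_Sn.
  by case: (n) n2 => [|[|[|]]].
have oS : (#|[set: 'S_n]%G| <= 2)%N by rewrite /= -surF card_in_imset.
have sq (hT : finGroupType) (H : {group hT}) : (#|H| <= 2)%N ->
    {in H &, forall x y, x != 1%g -> y != 1%g -> (x * y = 1)%g}.
  move=> oH x y xH yH x1 y1; apply/eqP; apply: contraT => xy1.
  suff : (2 < #|H|)%N by rewrite ltnNge oH.
  apply/card_gt2P; exists 1%g, x, (x * y)%g; rewrite group1 xH groupM //.
  split=> //; split=> //; first by rewrite eq_sym.
  by rewrite -{1}(mulg1 x) (inj_eq (mulgI x)) eq_sym.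
move=> x y xG yG; have [->|x1] := eqVneq x 1%g; first by rewrite F1 !mul1g.
have [->|y1] := eqVneq y 1%g; first by rewrite F1 !mulg1.
have nF z : z \in G -> z != 1%g -> F z != 1%g.
  by move=> zG; apply: contra => /eqP; rewrite -F1 => /injF -> //; rewrite group1.
by rewrite (sq _ _ oG) // (sq _ _ oS) ?inE ?nF.
Qed.

Theorem theoremA (R : realType) (n : nat) (hn : (1 <= n)%N)
  (gT : finGroupType) (G : {group gT}) (d : nat)
  (D : mx_representation R G d) (D_faithful : mx_faithful D)
  (D_Birkhoff : comb_equiv (rep_polytope D) (@Birkhoff R n)) :
  [/\ n = 3%N, cyclic G & #|G| = 6%N]
  \/ (effectively_equiv D (perm_repr R n) /\ G \isog [set: 'S_n]%g).
Proof.
have [F0 [inj0 sur0 cs0]] := comb_equiv_cell_system hn D_faithful D_Birkhoff.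
(* Right multiplication by a permutation permutes the cells, so [F] may be normalised at 1. *)
pose F g := (F0 g * (F0 1)^-1)%g.
have csF : cell_system D F by apply: cell_system_mulr.
have F1 : F 1%g = 1%g by rewrite /F mulgV.
have injF : {in G &, injective F} by move=> x y xG yG /mulIg; apply: inj0.
have surF : F @: G = [set: 'S_n].
  apply/setP=> s; rewrite inE; have : (s * F0 1)%g \in F0 @: G by rewrite sur0 inE.
  by case/imsetP=> g gG e; apply/imsetP; exists g; rewrite // /F -e mulgK.
have fin : (exists phi : {morphism G >-> 'S_n},
    isom G [set: 'S_n]%g phi /\ cell_system D phi) ->
  effectively_equiv D (perm_repr R n) /\ G \isog [set: 'S_n]%g.
  move=> [phi [isophi csphi]].
  have sG : G \subset (phi @*^-1 [set: 'S_n])%g.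
    by apply/subsetP=> g gG; apply/morphpreP; split; rewrite ?inE.
  split; last exact: isom_isog isophi.
  by exists phi, sG; split=> //; apply: perm_stably_equiv.
have [n2|n3] := leqP n 2.
  by right; apply/fin/(cell_system_isom injF surF csF)/card_le2_morph.
have [en|n4] := leqP n 3.
  have e3 : n = 3%N by lia.
  subst n; have [cG|ncG] := boolP (cyclic G).
    by left; split=> //; rewrite -(card_in_imset injF) surF cardsT card_Sn.
  by right; apply/fin/(cell_system_S3 injF).
right; apply: fin.
have [h|h] := cell_system_morph injF surF F1 csF n4; first exact: cell_system_isom h.
(* Inverting values turns an anti-isomorphism into an isomorphism and swaps the indices of the
   cells. *)
apply: (@cell_system_isom _ _ _ _ _ _ (fun g => (F g)^-1)%g).
- by move=> x y xG yG /invg_inj; apply: injF.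
- apply/setP=> s; rewrite inE; have : (s^-1)%g \in F @: G by rewrite surF inE.
  by case/imsetP=> g gG e; apply/imsetP; exists g; rewrite // -e invgK.
- exact: cell_system_inv.
- by move=> x y xG yG; rewrite h // invMg.
Qed.
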